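(* Let $n\ge 1$ and $\rho>1$, and let $E_\rho\subset\mathbb C$ be the open Bernstein ellipse (foci $\pm1$, semi-major plus semi-minor axis equal to $\rho$) with closure $\bar E_\rho$ and boundary $\partial E_\rho$. Let $A:\bar E_\rho\to\mathbb C^{n\times n}$ and $\boldsymbol b:\bar E_\rho\to\mathbb C^n$ be continuous on $\bar E_\rho$ and analytic on $E_\rho$, with $A(t)$ invertible for every $t\in\bar E_\rho$. Put $\boldsymbol x(t)=A(t)^{-1}\boldsymbol b(t)$ and $\kappa_\rho:=\max_{t\in\partial E_\rho}\|\boldsymbol x(t)\|_2$. Let $M\ge2$, $\Delta t=2/(M-1)$, and let $\tau_k=-1+(k-1)\Delta t$ for $k=1,\dots,M$ (equispaced points on $[-1,1]$). Let $R$ be a nonnegative integer with $R\le\frac12\sqrt{M-1}$, let $\mathbb P_R$ be the set of vector-valued polynomials $\boldsymbol p(t)=\boldsymbol v_0+\boldsymbol v_1t+\cdots+\boldsymbol v_Rt^R$ with $\boldsymbol v_j\in\mathbb C^n$, and let $$\boldsymbol p_R=\operatorname{argmin}_{\boldsymbol p\in\mathbb P_R}\big\|[\boldsymbol x(\tau_1)|\cdots|\boldsymbol x(\tau_M)]-[\boldsymbol p(\tau_1)|\cdots|\boldsymbol p(\tau_M)]\big\|_F.$$ Then for every $t\in\big(1,(\rho+\rho^{-1})/2\big)$, with $r=(t+\sqrt{t^2-1})/\rho<1$, $$\|\boldsymbol x(t)-\boldsymbol p_R(t)\|_2\le 2\kappa_\rho\Big[\frac{1}{1-r}+\frac{C(M,R)\,\rho}{(\rho-1)\sqrt{\rho^2r^2-1}}\Big]r^{R+1},$$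 where $C(M,R)=5\sqrt5\,\sqrt{2R+1}\,\sqrt M/\sqrt{2(M-1)}$.
   Context: $\|\cdot\|_2$ is the Euclidean norm, $\|\cdot\|_F$ the Frobenius norm. For $t>1$, $\boldsymbol x(t)$ denotes the value of the analytic extension (the point $t$ lies in $E_\rho$ for $t<(\rho+\rho^{-1})/2$). The least-squares minimizer $\boldsymbol p_R$ is unique since $R\le M-1$. *)

(* Defs.v *)
(* MathComp-Analysis over an abstract R : realType,
   complex numbers R[i] from mathcomp-real-closed (used through the
   regular-algebra alias R[i]^o, which carries the normed-module / topology
   structure of MathComp-Analysis over the scalar field R[i]). *)
From HB Require Import structures.
From mathcomp Require Import all_boot all_order all_algebra.
From mathcomp Require Import all_classical all_reals all_analysis.
From mathcomp.real_closed Require Import complex.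
Set Implicit Arguments. Unset Strict Implicit. Unset Printing Implicit Defensive.
Import Order.TTheory GRing.Theory Num.Theory.
Import numFieldNormedType.Exports.
Local Open Scope ring_scope.
Local Open Scope classical_set_scope.

Notation Cx R := (R[i])^o.

Definition cR {R : realType} (r : R) : Cx R := Complex r 0.

Definition cabs2 {R : realType} (z : Cx R) : R :=
  (complex.Re z) ^+ 2 + (complex.Im z) ^+ 2.
Definition cabs {R : realType} (z : Cx R) : R := Num.sqrt (cabs2 z).

Definition vnorm2 {R : realType} n (v : 'cV[Cx R]_n) : R :=
  Num.sqrt (\sum_(i < n) cabs2 (v i ord0)).

Definition frob {R : realType} m n (X : 'M[Cx R]_(m, n)) : R :=
  Num.sqrt (\sum_(i < m) \sum_(j < n) cabs2 (X i j)).

(* Bernstein ellipse E_rho: foci -1, 1, sum of distances to the foci equal to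
   rho + rho^-1 on the boundary (semi-major a = (rho+rho^-1)/2,
   semi-minor b = (rho-rho^-1)/2, so a + b = rho). *)
Definition bernstein_open {R : realType} (rho : R) : set (Cx R) :=
  [set z | cabs (z - 1) + cabs (z + 1) < rho + rho^-1].
Definition bernstein_closed {R : realType} (rho : R) : set (Cx R) :=
  [set z | cabs (z - 1) + cabs (z + 1) <= rho + rho^-1].
Definition bernstein_boundary {R : realType} (rho : R) : set (Cx R) :=
  [set z | cabs (z - 1) + cabs (z + 1) = rho + rho^-1].

(* analytic (= complex differentiable) at every point of D *)
Definition analytic_on {R : realType} m n (D : set (Cx R))
    (f : Cx R -> 'M[Cx R]_(m, n)) : Prop :=
  forall z, D z -> derivable f z 1.

Definition polyvec {R : realType} n d (V : 'I_d.+1 -> 'cV[Cx R]_n) (t : Cx R)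
  : 'cV[Cx R]_n :=
  \sum_(j < d.+1) t ^+ j *: V j.

(* equispaced nodes tau_k = -1 + (k-1) * 2/(M-1), k = 1..M
   (here indexed by k : 'I_M, i.e. k = 0..M-1) *)
Definition tau {R : realType} (M : nat) (k : 'I_M) : R :=
  -1 + k%:R * (2 / (M%:R - 1)).

Definition samples {R : realType} n M (f : Cx R -> 'cV[Cx R]_n)
  : 'M[Cx R]_(n, M) :=
  \matrix_(i < n, k < M) f (cR (tau k)) i ord0.

Definition solx {R : realType} n (A : Cx R -> 'M[Cx R]_n)
    (b : Cx R -> 'cV[Cx R]_n) (t : Cx R) : 'cV[Cx R]_n :=
  invmx (A t) *m b t.

Definition CMR {R : realType} (M d : nat) : R :=
  5 * Num.sqrt 5 * Num.sqrt (2 * d%:R + 1) * Num.sqrt M%:R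
    / Num.sqrt (2 * (M%:R - 1)).

(* Main.v *)
(** Pair everything with the error vector [w = x(t) - p_R(t)].  The scalar
    function [g = <w, x>] is holomorphic in the ellipse and bounded by
    [|w| kappa] on its boundary, and [Re <w, p_R>] is the real least-squares fit
    of [Re g] on the nodes; the claim is that [|w|^2 = Re (g t) - Re <w, p_R t>]
    is at most [|w|] times the announced bound.  Compare with the Chebyshev
    truncation [q] of [Re g].

    Pulled back by the Joukowski map, [g] lives on an annulus, and its Laurent
    coefficients are averages over circles.  These averages do not depend on the
    radius (Goursat's theorem, on rectangles in logarithmic polar coordinates),
    so the [k]-th coefficient is at most [|w| kappa rho^-k], and [Re g - q] is
    bounded by a geometric tail, both on [[-1, 1]] and at [t].  The expansion
    itself converges because writing [F z - F z0 = G z (z - z0)] makes its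
    partial sums telescope into two Laurent coefficients of [G].

    On the nodes, [p_R - q] is no larger than [Re g - q].  Since
    [4 R^2 <= M - 1], the trapezoidal rule and Markov's inequality in L2 bound
    the L2 norm of a polynomial of degree [R] by its values on the nodes, and its
    Legendre expansion, with [P_k t <= (t + sqrt (t^2 - 1))^k], extrapolates this
    to the point [t]. *)
Require Import Defs.
From HB Require Import structures.
From mathcomp Require Import all_boot all_order all_algebra.
From mathcomp Require Import all_classical all_reals all_analysis.
From mathcomp.real_closed Require Import complex polyrcf.
From mathcomp Require Import ring lra.
Set Implicit Arguments. Unset Strict Implicit. Unset Printing Implicit Defensive.
Import Order.TTheory GRing.Theory Num.Theory.
Import numFieldNormedType.Exports.
Local Open Scope ring_scope.

(** * Legendre polynomials and the discrete L2 norm *)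

(** Pairing with the error vector itself keeps the constants free of [n]: one scalar function
    replaces [n] components, and testing minimality against [eps * s * w], with [s] a real
    polynomial, gives the normal equations of a real scalar fit.

    [analytic_on] is bare pointwise differentiability, and the bound [kappa] lives on the boundary,
    where only continuity is known. This forces bisection in the interior, then a limit in the
    radius. The quotient [G] is likewise only known to be continuous at [z0], so its averages are
    compared on either side of the circle through [z0].

    In the final bound, the summand [1 / (1 - r)] is the Chebyshev tail at [t]. The other one is the
    tail on [[-1, 1]], of size [2 kappa rho^-R / (rho - 1)], amplified by the factor
    [s^(R+1) / sqrt (s^2 - 1)] with [s = rho r]. The constant [C(M,R)] leaves much room: its square
    is [125/2] times [(2 R + 1) M / (M - 1)], where the argument produces 8 times the same quantity,
    so the weights in the discrete estimate can be chosen crudely. *)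

Lemma nat_ind2 (P : nat -> Prop) : P 0%N -> P 1%N ->
  (forall n, P n -> P n.+1 -> P n.+2) -> forall n, P n.
Proof.
move=> P0 P1 PSS n; suff: P n /\ P n.+1 by case.
by elim: n => // n [Pn PSn]; split=> //; exact: PSS.
Qed.

(** * Integration of polynomials through formal primitives *)

Section poly_integral.
Context {R : rcfType}.
Implicit Types (p q : {poly R}) (a b c : R).

(** At index 0 the division by [0%:R] returns 0, so this primitive has no constant term. *)
Definition prim p : {poly R} := \poly_(i < (size p).+1) (p`_i.-1 / i%:R).

Lemma coef_prim p i : (prim p)`_i = p`_i.-1 / i%:R.
Proof.
rewrite coef_poly; case: ltnP => //; case: i => // i /= ip.
by rewrite nth_default ?mul0r.
Qed.

Lemma deriv_prim p : (prim p)^`() = p.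
Proof.
apply/polyP => i; rewrite coef_deriv coef_prim /= -[LHS]mulr_natr divfK // pnatr_eq0.
Qed.

(** This integral is purely algebraic, hence available over any real closed field; its positivity
    comes from the mean value theorem for polynomials. *)
Definition pint p a b := (prim p).[b] - (prim p).[a].

Lemma pintD p q a b : pint (p + q) a b = pint p a b + pint q a b.
Proof.
rewrite /pint (_ : prim (p + q) = prim p + prim q) ?hornerD; first by ring.
by apply/polyP => i; rewrite coefD !coef_prim coefD mulrDl.
Qed.

Lemma pintZ c p a b : pint (c *: p) a b = c * pint p a b.
Proof.
rewrite /pint (_ : prim (c *: p) = c *: prim p) ?hornerZ ?mulrBr //.
by apply/polyP => i; rewrite coefZ !coef_prim coefZ mulrA.
Qed.

Lemma pintB p q a b : pint (p - q) a b = pint p a b - pint q a b.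
Proof. by rewrite pintD -scaleN1r pintZ mulN1r. Qed.

Lemma pintMn p n a b : pint (n%:R * p) a b = n%:R * pint p a b.
Proof. by rewrite -polyC_natr mul_polyC pintZ. Qed.

Lemma pint_sum (I : Type) (r : seq I) (P : pred I) (F : I -> {poly R}) a b :
  pint (\sum_(i <- r | P i) F i) a b = \sum_(i <- r | P i) pint (F i) a b.
Proof.
elim: r => [|i r IH].
  by rewrite !big_nil -[X in pint X](scale0r 0) pintZ mul0r.
by rewrite !big_cons; case: ifP => // _; rewrite pintD IH.
Qed.

Lemma pint_deriv p a b : pint p^`() a b = p.[b] - p.[a].
Proof.
rewrite /pint (_ : prim _ = p - (p`_0)%:P) ?hornerD ?hornerN ?hornerC.
  by ring.
apply/polyP => -[|i]; rewrite coef_prim coefB coefC /=.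
  by rewrite invr0 mulr0 subrr.
by rewrite coef_deriv subr0 -[X in X / _]mulr_natr mulfK // pnatr_eq0.
Qed.

Lemma pint_cat p a b c : pint p a c = pint p a b + pint p b c.
Proof. by rewrite /pint; ring. Qed.

Lemma pint_ge0 p a b : a <= b -> (forall x, a <= x <= b -> 0 <= p.[x]) -> 0 <= pint p a b.
Proof.
rewrite le_eqVlt => /predU1P[->|ab] p0; first by rewrite /pint subrr.
have [c cab h] := poly_mvt (prim p) ab.
rewrite /pint h deriv_prim mulr_ge0 ?subr_ge0 ?(ltW ab) // p0 //.
by move: cab; rewrite in_itv /= => /andP[? ?]; rewrite !ltW.
Qed.

Lemma pint_le p q a b : a <= b -> (forall x, a <= x <= b -> p.[x] <= q.[x]) ->
  pint p a b <= pint q a b.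
Proof.
move=> ab pq; rewrite -subr_ge0 -pintB pint_ge0 // => x /pq.
by rewrite hornerD hornerN subr_ge0.
Qed.

End poly_integral.

(** * Legendre polynomials: orthogonality, growth outside the interval, Markov's inequality *)

Section legendre.
Context {R : rcfType}.
Implicit Types (p q : {poly R}).

Fixpoint leg_pair n : {poly R} * {poly R} :=
  if n is m.+1 then let u := leg_pair m in
    (u.2, (m.+2%:R^-1)%:P * ((2 * m + 3)%:R * 'X * u.2 - m.+1%:R * u.1))
  else (1, 'X).
(* Locked: rewriting would otherwise unfold the recursion up to conversion. *)
Definition leg := locked (fun n => (leg_pair n).1).

Lemma leg0 : leg 0 = 1. Proof. by rewrite /leg -lock. Qed.
Lemma leg1 : leg 1 = 'X. Proof. by rewrite /leg -lock. Qed.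

Lemma legSS n : leg n.+2 =
  (n.+2%:R^-1)%:P * ((2 * n + 3)%:R * 'X * leg n.+1 - n.+1%:R * leg n).
Proof. by rewrite /leg -lock. Qed.

Lemma bonnet n : n.+2%:R * leg n.+2 = (2 * n + 3)%:R * 'X * leg n.+1 - n.+1%:R * leg n.
Proof.
by rewrite legSS mulrA -polyC_natr -polyCM mulfV ?pnatr_eq0 // mul1r.
Qed.

Lemma natp_neq0 n : n.+1%:R != 0 :> {poly R}.
Proof. by rewrite -polyC_natr polyC_eq0 pnatr_eq0. Qed.

(** The two recurrences are proved together because they feed each other: differentiating [bonnet]
    and using the second one gives the next instance of the first, and both are then used for the
    next instance of the second. *)
Lemma leg_deriv n : (leg n.+1)^`() = 'X * (leg n)^`() + n.+1%:R * leg n /\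
  'X * (leg n.+1)^`() - (leg n)^`() = n.+1%:R * leg n.+1.
Proof.
elim: n => [|n [IHA IHB]].
  by rewrite leg0 leg1 derivX -polyC1 derivC; split; ring.
have E : n.+2%:R * (leg n.+2)^`() =
    (2 * n + 3)%:R * (leg n.+1 + 'X * (leg n.+1)^`()) - n.+1%:R * (leg n)^`().
  rewrite -[LHS]addr0 -[X in _ + X](mul0r (leg n.+2)) -(derivC (n.+2%:R : R)) polyC_natr.
  rewrite addrC -derivM bonnet derivB !derivM derivX -!polyC_natr !derivC !polyC_natr.
  by ring.
have IHB' : (leg n)^`() = 'X * (leg n.+1)^`() - n.+1%:R * leg n.+1.
  by rewrite -IHB; ring.
have A : (leg n.+2)^`() = 'X * (leg n.+1)^`() + n.+2%:R * leg n.+1.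
  apply: (mulfI (natp_neq0 n.+1)); rewrite E IHB'.
  by rewrite natrD natrM -!natr1; ring.
split=> //; apply: (mulfI (natp_neq0 n.+1)).
have A' : leg n.+2 * n.+2%:R = (2 * n + 3)%:R * 'X * leg n.+1 - n.+1%:R * leg n.
  by rewrite -bonnet mulrC.
have IHA' : n.+1%:R * leg n = (leg n.+1)^`() - 'X * (leg n)^`() by rewrite IHA; ring.
rewrite [n.+2%:R * leg n.+2]bonnet IHA' A IHB' natrD natrM -!natr1; ring.
Qed.

Lemma leg_deriv_diff n : (leg n.+2)^`() = (leg n)^`() + (2 * n + 3)%:R * leg n.+1.
Proof.
rewrite (leg_deriv n.+1).1; have := (leg_deriv n).2.
move/(canRL (subrK _)) => ->; rewrite natrD natrM -!natr1; ring.
Qed.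

Lemma leg_ode n : (('X ^+ 2 - 1) * (leg n)^`())^`() = (n * n.+1)%:R * leg n.
Proof.
case: n => [|n].
  by rewrite leg0 -polyC1 derivC mulr0 mul0n mul0r -polyC0 derivC.
have -> : ('X ^+ 2 - 1) * (leg n.+1)^`() = n.+1%:R * ('X * leg n.+1 - leg n).
  have [A B] := leg_deriv n.
  have -> : n.+1%:R * ('X * leg n.+1 - leg n) = 'X * (n.+1%:R * leg n.+1) - n.+1%:R * leg n.
    by ring.
  by rewrite -B A; ring.
have [A B] := leg_deriv n.
rewrite derivM -polyC_natr derivC mul0r add0r polyC_natr derivB derivM derivX.
have -> : 1 * leg n.+1 + 'X * (leg n.+1)^`() - (leg n)^`() = leg n.+1 + n.+1%:R * leg n.+1.
  by rewrite -B; ring.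
by rewrite natrM -[n.+2%:R]natr1; ring.
Qed.

Notation I p := (pint p (-1) 1).

(** The operator in [leg_ode] is symmetric, the boundary terms of the integration by parts being
    killed by ['X ^+ 2 - 1] at both ends, and the eigenvalues [n * n.+1] are distinct. *)
Lemma leg_orth m n : m != n -> I (leg m * leg n) = 0.
Proof.
have key k l : (k * k.+1)%:R * I (leg k * leg l) =
    - I (('X ^+ 2 - 1) * (leg k)^`() * (leg l)^`()).
  rewrite -pintMn mulrA -leg_ode.
  have := pint_deriv (('X ^+ 2 - 1) * (leg k)^`() * leg l) (-1) 1.
  rewrite (derivM (('X ^+ 2 - 1) * (leg k)^`()) (leg l)).
  have A0 (x : R) : x ^+ 2 = 1 -> (('X ^+ 2 - 1) * (leg k)^`() * leg l).[x] = 0.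
    by move=> x2; rewrite !hornerM hornerD hornerN hornerXn hornerC x2 subrr !mul0r.
  rewrite (pintD (_ * leg l)) !A0 ?sqrrN ?expr1n // subrr => /eqP.
  by rewrite addr_eq0 => /eqP.
move=> mn; have : (m * m.+1)%:R * I (leg m * leg n) = (n * n.+1)%:R * I (leg m * leg n).
  rewrite key [leg m * leg n]mulrC key; congr (- pint _ _ _); ring.
move/eqP; rewrite -subr_eq0 -mulrBl mulf_eq0 => /orP[|/eqP //].
rewrite subr_eq0 eqr_nat => /eqP h; case/eqP: mn.
have [lt|lt|//] := ltngtP m n.
  have : (m * m.+1 < n * n.+1)%N by rewrite ltn_mul.
  by rewrite h ltnn.
have : (n * n.+1 < m * m.+1)%N by rewrite ltn_mul.
by rewrite h ltnn.
Qed.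

(** Multiplying [bonnet n] by [leg n.+2] and [bonnet n.+1] by [leg n.+1] expresses the integral of
    ['X * leg n.+1 * leg n.+2] in two ways, which ties two consecutive norms together. *)
Lemma leg_norm n : I (leg n ^+ 2) = 2 / (2 * n + 1)%:R.
Proof.
elim/nat_ind2: n => [||n _ IH].
- have := @pint_deriv R 'X (-1) 1; rewrite derivX leg0 expr1n !hornerE => ->.
  by rewrite divr1; ring.
- have := @pint_deriv R ('X ^+ 3) (-1) 1; rewrite derivXn leg1 /= -mulr_natl pintMn.
  rewrite !hornerXn => h.
  have n3 : 3%:R != 0 :> R by rewrite pnatr_eq0.
  apply: (mulfI n3); rewrite [LHS]h.
  by field.
have h1 : n.+2%:R * I (leg n.+2 ^+ 2) = (2 * n + 3)%:R * I ('X * leg n.+1 * leg n.+2).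
  rewrite -pintMn expr2 mulrA bonnet mulrBl pintB -!mulrA !pintMn (@leg_orth n n.+2) ?mulr0 ?subr0 //.
  by rewrite neq_ltn ltnS leqnSn.
have h2 : (2 * n + 5)%:R * I ('X * leg n.+1 * leg n.+2) = n.+2%:R * I (leg n.+1 ^+ 2).
  have := pintMn (leg n.+3 * leg n.+1) n.+3 (-1) 1.
  rewrite (@leg_orth n.+3 n.+1) ?mulr0; last by rewrite neq_ltn !ltnS leqnSn orbT.
  rewrite mulrA bonnet mulrBl pintB -!mulrA !pintMn => /eqP; rewrite subr_eq0 => /eqP h.
  rewrite expr2 -h (_ : 2 * n.+1 + 3 = 2 * n + 5)%N; last by rewrite mulnS addnAC addnC addnA addnC.
  by congr (_ * pint _ _ _); ring.
rewrite (_ : 2 * n.+2 + 1 = 2 * n + 5)%N; last by rewrite !mulnS; ring.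
rewrite (_ : 2 * n.+1 + 1 = 2 * n + 3)%N in IH; last by rewrite !mulnS; ring.
have n5 : (2 * n + 5)%:R != 0 :> R by rewrite pnatr_eq0 addnS.
have n3 : (2 * n + 3)%:R != 0 :> R by rewrite pnatr_eq0 addnS.
have n2 : n.+2%:R != 0 :> R by rewrite pnatr_eq0.
apply: (mulfI n2); rewrite h1; apply: (mulfI n5); rewrite mulrCA h2 IH.
by field; rewrite -natrM -!natrD n5 n3.
Qed.

(** By [leg_deriv_diff] the derivative of [leg n] is a combination of the [leg k] with [k < n]. *)
Lemma leg_deriv_orth n m : (n <= m)%N -> I (leg m * (leg n)^`()) = 0.
Proof.
elim/nat_ind2: n m => [||n IH _] m nm.
- by rewrite leg0 -polyC1 derivC mulr0 -[0](scale0r 0) pintZ mul0r.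
- by rewrite leg1 derivX -leg0 leg_orth // -lt0n.
rewrite leg_deriv_diff mulrDr pintD IH; last by rewrite (leq_trans _ nm) // !leqW.
by rewrite mulrCA pintMn leg_orth ?mulr0 ?addr0 // gtn_eqF.
Qed.

Lemma leg_deriv_norm n : I ((leg n)^`() ^+ 2) = (n * n.+1)%:R.
Proof.
elim/nat_ind2: n => [||n IH _].
- by rewrite leg0 -polyC1 derivC expr0n -[0%:R](scale0r 0) pintZ mul0r mul0n.
- have := leg_norm 0; rewrite leg0 leg1 derivX => ->.
  by rewrite muln0 add0n divr1.
rewrite leg_deriv_diff sqrrD pintD pintD IH exprMn.
have -> : ((leg n)^`() * ((2 * n + 3)%:R * leg n.+1)) *+ 2 =
    (2 * n + 3)%:R * (2%:R * (leg n.+1 * (leg n)^`())) by rewrite -mulr_natl; ring.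
rewrite !pintMn leg_deriv_orth // !mulr0 addr0 -natrX pintMn leg_norm.
rewrite (_ : 2 * n.+1 + 1 = 2 * n + 3)%N; last by rewrite !mulnS; ring.
have n3 : (2 * n + 3)%:R != 0 :> R by rewrite pnatr_eq0 addnS.
have E x : x != 0 -> x ^+ 2 * (2 / x) = 2 * x :> R by move=> x0; field.
by rewrite natrX E // -natrM -natrD; congr _%:R; ring.
Qed.

Lemma size_leg n : (size (leg n) <= n.+1)%N.
Proof.
elim/nat_ind2: n => [||n IH IHS]; rewrite ?leg0 ?leg1 ?size_poly1 ?size_polyX //.
rewrite legSS mul_polyC (leq_trans (size_scale_leq _ _)) //.
rewrite (leq_trans (size_polyD _ _)) // geq_max size_polyN; apply/andP; split.
  rewrite -polyC_natr -mulrA mul_polyC (leq_trans (size_scale_leq _ _)) //.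
  by rewrite (leq_trans (size_polyMleq _ _)) // size_polyX; exact: IHS.
by rewrite -polyC_natr mul_polyC (leq_trans (size_scale_leq _ _)) // (leq_trans IH) // leqW.
Qed.

Lemma leg_lead n : 0 < (leg n)`_n.
Proof.
elim/nat_ind2: n => [||n IH IHS].
- by rewrite leg0 coef1.
- by rewrite leg1 coefX.
rewrite legSS mul_polyC coefZ coefB.
rewrite -!polyC_natr -mulrA !mul_polyC !coefZ coefXM /=.
rewrite [(leg n)`_n.+2]nth_default ?mulr0 ?subr0; last exact: leq_trans (size_leg n) _.
by rewrite !mulr_gt0 ?invr_gt0 ?ltr0n // addnS.
Qed.

Lemma leg_span n p : (size p <= n)%N -> exists c : nat -> R, p = \sum_(k < n) c k *: leg k.
Proof.
elim: n p => [|n IH] p.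
  by rewrite leqn0 size_poly_eq0 => /eqP ->; exists (fun=> 0); rewrite big_ord0.
move=> sp; pose a := p`_n / (leg n)`_n.
have [|c cE] := IH (p - a *: leg n).
  apply/leq_sizeP => j; rewrite leq_eqVlt => /predU1P[<-|nj].
    by rewrite coefB coefZ divfK ?subrr // gt_eqF // leg_lead.
  rewrite coefB coefZ !nth_default ?mulr0 ?subr0 //; first exact: leq_trans (size_leg n) nj.
  exact: leq_trans sp nj.
exists (fun k => if k == n then a else c k).
rewrite big_ord_recr /= eqxx -[LHS](subrK (a *: leg n)) cE; congr (_ + _).
by apply: eq_bigr => k _; rewrite ltn_eqF.
Qed.

Lemma leg_parseval n (c : nat -> R) :
  I ((\sum_(k < n) c k *: leg k) ^+ 2) = \sum_(k < n) c k ^+ 2 * (2 / (2 * k + 1)%:R).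
Proof.
elim: n => [|n IH]; first by rewrite !big_ord0 expr0n -[0%:R](scale0r 0) pintZ mul0r.
rewrite !big_ord_recr /= sqrrD !pintD IH exprZn pintZ leg_norm; congr (_ + _).
rewrite -[RHS]addr0; congr (_ + _).
rewrite -scalerAr pintZ mulr_suml pint_sum big1 ?mulr0 ?addr0 // => k _.
by rewrite -scalerAl pintZ leg_orth ?mulr0 // ltn_eqF.
Qed.

(** Here [s] is [t + sqrt (t^2 - 1)]. Bounding the ratio of consecutive values, instead of the
    values, closes the induction: in [bonnet] the earlier value enters with a minus sign, and the
    upper ratio bound supplies the lower bound [s^-1 * (leg n.+1).[t]] for it. *)
Lemma leg_ratio n (t s : R) : 1 <= t -> 1 <= s -> s + s^-1 = 2 * t ->
  [/\ 0 < (leg n).[t], (leg n).[t] <= (leg n.+1).[t]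
    & (leg n.+1).[t] <= s * (leg n).[t]].
Proof.
move=> t1 s1 st; have s0 : 0 < s by exact: lt_le_trans s1.
have sV1 : s^-1 <= 1 by rewrite invf_le1.
elim: n => [|n [L0 LS LsS]].
  by rewrite leg0 leg1 hornerC hornerX mulr1; split=> //; lra.
have L1 := lt_le_trans L0 LS.
have := congr1 (fun p => p.[t]) (bonnet n).
rewrite /= hornerD hornerN !hornerM hornerX -!polyC_natr !hornerC.
have vb : s^-1 * (leg n.+1).[t] <= (leg n).[t] by rewrite ler_pdivrMl.
move: (leg n).[t] (leg n.+1).[t] (leg n.+2).[t] L0 LS LsS L1 vb => a b c a0 ab bsa b0 vb.
rewrite natrD natrM -[n.+2%:R]natr1 -natr1.
have N0 : 0 <= n%:R :> R by rewrite ler0n.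
move: (n%:R) (s^-1) N0 sV1 st vb => N v N0 v1 st vb E.
have N2 : 0 < N + 1 + 1 by lra.
split=> //.
- rewrite -(ler_pM2l N2) E.
  have : 0 <= (t - 1) * b * (2 * N + 3) by rewrite !mulr_ge0 ?subr_ge0 ?(ltW b0) //; lra.
  have : 0 <= (N + 1) * (b - a) by rewrite mulr_ge0 ?subr_ge0 //; lra.
  lra.
- rewrite -(ler_pM2l N2) E.
  have -> : t = (s + v) / 2 by rewrite st; field.
  have : 0 <= (N + 1) * (a - v * b) by rewrite mulr_ge0 ?subr_ge0 //; lra.
  have : 0 <= (s - v) * b by rewrite mulr_ge0 ?(ltW b0) //; lra.
  lra.
Qed.

Lemma leg_growth n (t s : R) : 1 <= t -> 1 <= s -> s + s^-1 = 2 * t ->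
  0 <= (leg n).[t] <= s ^+ n.
Proof.
move=> t1 s1 st; have s0 : 0 <= s by exact: le_trans s1.
elim: n => [|n /andP[IH0 IH]]; first by rewrite leg0 hornerC expr0 ler01 lexx.
have [L0 LS LsS] := leg_ratio n t1 s1 st.
rewrite (le_trans (ltW L0)) //= (le_trans LsS) // exprS ler_wpM2l //.
Qed.

Lemma weighted_cauchy_schwarz (J : Type) (js : seq J) (c x w : J -> R) :
  (forall k, 0 < w k) ->
  (\sum_(k <- js) c k * x k) ^+ 2 <=
  (\sum_(k <- js) c k ^+ 2 / w k) * (\sum_(k <- js) w k * x k ^+ 2).
Proof.
move=> w0; elim: js => [|n js IH]; first by rewrite !big_nil expr0n mul0r.
have A0 : 0 <= \sum_(k <- js) c k ^+ 2 / w k.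
  by apply: sumr_ge0 => k _; rewrite divr_ge0 ?sqr_ge0 // ltW.
have B0 : 0 <= \sum_(k <- js) w k * x k ^+ 2.
  by apply: sumr_ge0 => k _; rewrite mulr_ge0 ?sqr_ge0 // ltW.
rewrite !big_cons; move: IH A0 B0; set S := \sum_(_ <- _) _.
set A := \sum_(_ <- _) _; set B := \sum_(_ <- _) _ => IH A0 B0.
have v0 : 0 <= c n ^+ 2 / w n by rewrite divr_ge0 ?sqr_ge0 // ltW.
have u0 : 0 <= w n * x n ^+ 2 by rewrite mulr_ge0 ?sqr_ge0 // ltW.
have uv : (c n ^+ 2 / w n) * (w n * x n ^+ 2) = (c n * x n) ^+ 2.
  by field; rewrite gt_eqF.
move: (c n ^+ 2 / w n) (w n * x n ^+ 2) (c n * x n) v0 u0 uv => v u y v0 u0 uv.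
(* The square of the left side is at most [4 * A * B * u * v] by the induction hypothesis, hence at
   most the square of the right side by AM-GM. *)
have cross : 2 * (S * y) <= A * u + B * v.
  apply: le_trans (ler_norm _) _.
  rewrite -(@ler_pXn2r _ 2) ?nnegrE ?addr_ge0 ?mulr_ge0 // real_normK ?num_real //.
  have : S ^+ 2 * y ^+ 2 <= A * B * (v * u) by rewrite uv ler_wpM2r ?sqr_ge0.
  have := sqr_ge0 (A * u - B * v); lra.
lra.
Qed.

(** Every weight is replaced by the largest one, which leaves a geometric sum of ratio [s ^+ 2]. The
    factors [sqrt (2 R + 1)] and [1 / sqrt (rho^2 r^2 - 1)] of the theorem originate here. *)
Lemma sum_weights_pow d (s : R) : 1 < s ->
  \sum_(k < d.+1) (2 * k + 1)%:R / 2 * s ^+ k ^+ 2 <=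
  (2 * d + 1)%:R / 2 * (s ^+ d.+1 ^+ 2 / (s ^+ 2 - 1)).
Proof.
move=> s1; have s2 : 0 < s ^+ 2 - 1 by rewrite subr_gt0 exprn_egt1 // ltW.
have s0 : 0 <= s by rewrite (le_trans ler01) // ltW.
apply: (@le_trans _ _ (\sum_(k < d.+1) (2 * d + 1)%:R / 2 * s ^+ k ^+ 2)).
  apply: ler_sum => k _; rewrite ler_wpM2r ?sqr_ge0 // ler_pM2r ?invr_gt0 //.
  by rewrite ler_nat leq_add2r leq_mul2l -ltnS ltn_ord orbT.
rewrite -mulr_sumr ler_wpM2l ?divr_ge0 // ler_pdivlMr //.
suff -> : (\sum_(i < d.+1) s ^+ i ^+ 2) * (s ^+ 2 - 1) = s ^+ d.+1 ^+ 2 - 1 by lra.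
elim: d => [|d IH]; first by rewrite big_ord_recl big_ord0 expr0 expr1; ring.
rewrite big_ord_recr /= mulrDl IH [s ^+ d.+2]exprS; ring.
Qed.

(* The weights [(2 k + 1) / 2] are the inverse squared L2 norms of the [P_k]. *)
Lemma poly_growth d p (t s : R) : (size p <= d.+1)%N ->
  1 <= t -> 1 < s -> s + s^-1 = 2 * t ->
  p.[t] ^+ 2 <= (2 * d + 1)%:R / 2 * (s ^+ d.+1 ^+ 2 / (s ^+ 2 - 1)) * I (p ^+ 2).
Proof.
move=> /leg_span[c ->] t1 s1 st; rewrite leg_parseval horner_sum.
have := @weighted_cauchy_schwarz 'I_d.+1 (index_enum _) c (fun k => (leg k).[t])
    (fun k => (2 * k + 1)%:R / 2).
move=> /(_ _)/wrap[k|]; first by rewrite divr_gt0 // ltr0n addn1.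
under [in X in X ^+ 2 <= _ -> _]eq_bigr do rewrite -hornerZ.
move=> h; apply: le_trans h _; rewrite mulrC.
under [X in _ * X <= _]eq_bigr do rewrite invf_div.
rewrite ler_wpM2r //.
  by apply: sumr_ge0 => k _; rewrite mulr_ge0 ?sqr_ge0 ?divr_ge0.
apply: le_trans (sum_weights_pow d s1); apply: ler_sum => k _.
rewrite ler_wpM2l // ?divr_ge0 // ler_pXn2r //.
  by case/andP: (leg_growth k t1 (ltW s1) st).
all: by rewrite nnegrE; case/andP: (leg_growth k t1 (ltW s1) st) => // h1 h2; exact: le_trans h2.
Qed.

Lemma sum_weights_deriv d : \sum_(k < d.+1) (2 * k + 1)%:R / 2 * (k * k.+1)%:R =
  (d * d.+1 ^ 2 * d.+2)%:R / 4 :> R.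
Proof.
elim: d => [|d IH]; first by rewrite big_ord_recl big_ord0 !mul0n mulr0 mul0r addr0.
by rewrite big_ord_recr /= IH !expnS expn0 !natrM !natrD !natrM -!natr1; field.
Qed.

(** The derivatives of the [leg k] are not orthogonal, so Cauchy-Schwarz is applied at each point
    [x] to the differentiated expansion, and the result is integrated afterwards with
    [leg_deriv_norm]. *)
Lemma markov_l2 d p : (size p <= d.+1)%N ->
  I (p^`() ^+ 2) <= (d * d.+1 ^ 2 * d.+2)%:R / 4 * I (p ^+ 2).
Proof.
move=> /leg_span[c ->]; rewrite leg_parseval -sum_weights_deriv.
set A := \sum_(k < _) c k ^+ 2 * _.
apply: (@le_trans _ _ (I (A *: \sum_(k < d.+1) ((2 * k + 1)%:R / 2) *: (leg k)^`() ^+ 2))).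
  apply: pint_le => [|x _]; first by lra.
  rewrite horner_exp raddf_sum /= horner_sum hornerZ horner_sum.
  have := @weighted_cauchy_schwarz 'I_d.+1 (index_enum _) c (fun k => (leg k)^`().[x])
    (fun k => (2 * k + 1)%:R / 2).
  move=> /(_ _)/wrap[k|]; first by rewrite divr_gt0 // ltr0n addn1.
  under [X in X * _]eq_bigr do rewrite invf_div.
  rewrite -/A.
  under [X in X ^+ 2]eq_bigr do rewrite -hornerZ -derivZ.
  by under [X in _ * X]eq_bigr do rewrite -horner_exp -hornerZ.
rewrite pintZ pint_sum mulrC.
by under eq_bigr do rewrite pintZ leg_deriv_norm.
Qed.

End legendre.

(** * The trapezoidal rule on an equispaced grid *)

Section trapezoid.
Context {R : rcfType}.
Implicit Types (p q : {poly R}).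

(* [lam] is the weight of the AM-GM inequality applied to the integral of
   [(x - m) p p'], with [m] the midpoint of the cell. *)
Lemma trapezoid_cell p (a b lam : R) : a <= b -> 0 < lam ->
  pint (p ^+ 2) a b <= (b - a) / 2 * (p.[a] ^+ 2 + p.[b] ^+ 2) +
    (b - a) / 2 * (lam * pint (p ^+ 2) a b + lam^-1 * pint (p^`() ^+ 2) a b).
Proof.
move=> ab lam0; pose m := (a + b) / 2.
(* Integration by parts: as [m] is the midpoint, the boundary values of [('X - m%:P) * p ^+ 2] add
   up to the trapezoidal sum. *)
have E : pint (p ^+ 2) a b + pint (2%:R * (('X - m%:P) * (p * p^`()))) a b =
    (b - a) / 2 * (p.[a] ^+ 2 + p.[b] ^+ 2).
  have D : (('X - m%:P) * p ^+ 2)^`() = p ^+ 2 + 2%:R * (('X - m%:P) * (p * p^`())).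
    by rewrite derivM derivXsubC !expr2 derivM; ring.
  rewrite -pintD -D pint_deriv.
  by rewrite !(hornerM, hornerXsubC) /m; field.
rewrite -E -addrA -lerBlDl subrr -pintZ -pintZ -pintD -pintZ -pintD.
apply: pint_ge0 => // x /andP[ax xb].
rewrite -polyC_natr !(hornerD, hornerZ, hornerM, hornerN, hornerX, horner_exp, hornerC).
set u := p.[x]; set v := p^`().[x]; set h := (b - a) / 2.
have xm : - h <= x - m <= h by rewrite /h /m; apply/andP; split; lra.
have h0 : 0 <= h by rewrite /h; lra.
have amgm : 2 * `|u * v| <= lam * u ^+ 2 + lam^-1 * v ^+ 2.
  rewrite -subr_ge0 (_ : _ - _ = lam^-1 * (lam * `|u| - `|v|) ^+ 2).
    by rewrite mulr_ge0 ?sqr_ge0 // invr_ge0 ltW.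
  rewrite normrM -(real_normK (num_real u)) -(real_normK (num_real v)).
  by field; rewrite gt_eqF.
have : `|2 * ((x - m) * (u * v))| <= h * (2 * `|u * v|).
  rewrite normrM [`|_ * (u * v)|]normrM ger0_norm // mulrCA ler_wpM2r ?mulr_ge0 //.
  by rewrite ler_norml.
have := ler_wpM2l h0 amgm.
rewrite ler_norml => ? /andP[? _]; lra.
Qed.

Definition node (h : R) k : R := -1 + k%:R * h.

Lemma trapezoid p (h lam : R) N : 0 <= h -> 0 < lam ->
  pint (p ^+ 2) (-1) (node h N) <= h * \sum_(k < N.+1) p.[node h k] ^+ 2 +
    h / 2 * (lam * pint (p ^+ 2) (-1) (node h N) + lam^-1 * pint (p^`() ^+ 2) (-1) (node h N)).
Proof.
move=> h0 lam0.
suff H : pint (p ^+ 2) (-1) (node h N) <=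
    h / 2 * (\sum_(k < N) p.[node h k] ^+ 2 + \sum_(k < N) p.[node h k.+1] ^+ 2) +
    h / 2 * (lam * pint (p ^+ 2) (-1) (node h N) + lam^-1 * pint (p^`() ^+ 2) (-1) (node h N)).
  apply: le_trans H _; rewrite lerD2r.
  have h1 : \sum_(k < N) p.[node h k] ^+ 2 <= \sum_(k < N.+1) p.[node h k] ^+ 2.
    by rewrite big_ord_recr lerDl sqr_ge0.
  have h2 : \sum_(k < N) p.[node h k.+1] ^+ 2 <= \sum_(k < N.+1) p.[node h k] ^+ 2.
    by rewrite big_ord_recl lerDr sqr_ge0.
  have := ler_wpM2l h0 h1; have := ler_wpM2l h0 h2; lra.
elim: N => [|N IH].
  have -> : node h 0 = -1 by rewrite /node mulr0n mul0r addr0.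
  by rewrite !big_ord0 /pint !subrr !(mulr0, addr0).
have xS : node h N.+1 - node h N = h by rewrite /node -natr1; ring.
have xN : node h N <= node h N.+1 by rewrite -subr_ge0 xS.
have := trapezoid_cell p xN lam0; rewrite xS !big_ord_recr /=.
rewrite (pint_cat (p ^+ 2) (-1) (node h N)) (pint_cat (p^`() ^+ 2) (-1) (node h N)); lra.
Qed.

(** The error of the trapezoidal rule for [p ^+ 2] is a fraction below 1 of the integral [A] itself,
    so it can be absorbed on the left. The condition on [d] and [M] makes the grid fine enough for
    Markov's inequality to ensure this. *)
Lemma grid_bound d p M : (2 <= M)%N -> (size p <= d.+1)%N ->
  4 * d%:R ^+ 2 <= M%:R - 1 :> R ->
  pint (p ^+ 2) (-1) 1 <=
    16 / (M%:R - 1) * \sum_(k < M) p.[-1 + k%:R * (2 / (M%:R - 1))] ^+ 2.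
Proof.
case: M => [//|N]; rewrite ltnS => N1 sp.
have NE : N.+1%:R - 1 = N%:R :> R by rewrite mulrS addrAC subrr add0r.
rewrite NE => dN.
have N0 : 0 < N%:R :> R by rewrite ltr0n.
have := markov_l2 sp.
set S := \sum_(k < _) _; set h := 2 / _ in S *; set B := pint (_^`() ^+ 2) _ _; set A := pint _ _ _ => AB.
have h0 : 0 <= h by rewrite divr_ge0 // ltW.
have A0 : 0 <= A by apply: pint_ge0 => [|x _]; [lra|rewrite horner_exp sqr_ge0].
have Nh : -1 + N%:R * h = 1 by rewrite /h; field; rewrite gt_eqF.
have T lam : 0 < lam -> A <= h * S + h / 2 * (lam * A + lam^-1 * B).
  by move=> lam0; have := trapezoid p N h0 lam0; rewrite /node Nh.
have -> : 16 / N%:R = 8 * h by rewrite /h; field; rewrite gt_eqF.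
have S0 : 0 <= h * S by rewrite mulr_ge0 // sumr_ge0 // => k _; exact: sqr_ge0.
case: d sp dN AB => [|d] sp dN.
  (* For a constant polynomial the grid condition carries no information, but [B <= 0] and [h <= 2],
     so the weight [1 / 2] makes the error at most [A / 2]. *)
  rewrite !mul0n mul0r mul0r => B0; have := T (1 / 2); rewrite divr_gt0 // => /(_ isT).
  have h2 : h <= 2 by rewrite ler_pdivrMr // ler_peMr // ler1n.
  have := ler_wpM2r A0 h2; rewrite div1r invrK => h2A.
  have := mulr_ge0_le0 h0 B0; lra.
set D : R := d.+1%:R ^+ 2 in dN *.
have D0 : 0 < D by rewrite exprn_gt0 // ltr0n.
have hD : h * D <= 1 / 2 by rewrite /h mulrAC ler_pdivrMr //; lra.
(* The constant of Markov's inequality divided by the fourth power of the degree is largest in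
   degree 1, where it equals 3. *)
move=> AB; have {}AB : B <= 3 * D ^+ 2 * A.
  apply: le_trans AB _; rewrite ler_wpM2r //.
  have d0 : 0 <= d%:R :> R by rewrite ler0n.
  have [e1 e2 e3] : [/\ d.+1%:R = d%:R + 1 :> R, d.+2%:R = d%:R + 2 :> R & d.+3%:R = d%:R + 3 :> R].
    by split; [rewrite -addn1|rewrite -addn2|rewrite -addn3]; rewrite natrD.
  rewrite /D !natrM ?natrX e1 e2 e3.
  move: (d%:R) d0 => y d0.
  have := mulr_ge0 d0 d0; have := mulr_ge0 d0 (mulr_ge0 d0 d0).
  have := mulr_ge0 d0 (mulr_ge0 d0 (mulr_ge0 d0 d0)); lra.
(* With this weight the error is at most [7 / 4 * h * D * A], hence at most [7 / 8 * A]; absorbing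
   it costs the factor 8. *)
have := T (2 * D); rewrite mulr_gt0 // => /(_ isT) TD.
have h1 : (2 * D)^-1 * B <= 3 / 2 * D * A.
  by rewrite ler_pdivrMl ?mulr_gt0 // (le_trans AB) //; lra.
have h2 := ler_wpM2l h0 h1; have h3 := ler_wpM2r A0 hD; lra.
Qed.

End trapezoid.

Local Open Scope classical_set_scope.

(** * Goursat's theorem for rectangles *)

Section segment_integral.
Context {R : realType}.
Implicit Types (f g : R -> R) (a b c e : R).

Definition sint f a b : R := \int[lebesgue_measure]_(x in `[a, b]) f x.

Lemma continuous_integrable f a b : continuous f ->
  lebesgue_measure.-integrable `[a, b] (EFin \o f).
Proof.
move=> cf; apply: continuous_compact_integrable; first exact: segment_compact.
exact: continuous_subspaceT.
Qed.

Lemma sint_split f a b c : continuous f -> a <= b -> b <= c ->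
  sint f a c = sint f a b + sint f b c.
Proof.
move=> cf ab bc; have := @Rintegral_itvB R f (BLeft a) (BRight c) b.
rewrite !bnd_simp => /(_ (continuous_integrable a c cf) ab bc) h.
rewrite /sint -[X in _ + X]Rintegral_itv_obnd_cbnd -?h; first by rewrite addrC subrK.
by apply: integrableS (continuous_integrable b c cf) => //; apply: subset_itvr; rewrite bnd_simp.
Qed.

Lemma sintB f g a b : continuous f -> continuous g ->
  sint (fun x => f x - g x) a b = sint f a b - sint g a b.
Proof. by move=> cf cg; rewrite /sint RintegralB //; exact: continuous_integrable. Qed.

Lemma sintD f g a b : continuous f -> continuous g ->
  sint (fun x => f x + g x) a b = sint f a b + sint g a b.
Proof. by move=> cf cg; rewrite /sint RintegralD //; exact: continuous_integrable. Qed.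

Lemma sintZ f k a b : continuous f ->
  sint (fun x => k * f x) a b = k * sint f a b.
Proof. by move=> cf; rewrite /sint RintegralZl //; exact: continuous_integrable. Qed.

Lemma sint_cst k a b : a <= b -> sint (fun=> k) a b = k * (b - a).
Proof.
move=> ab; rewrite /sint Rintegral_cst //= lebesgue_measure_itv /= lte_fin.
by case: ltgtP ab => //= -> _; rewrite subrr.
Qed.

Lemma sint_le f g a b : continuous f -> continuous g ->
  (forall x, a <= x <= b -> f x <= g x) -> sint f a b <= sint g a b.
Proof.
by move=> cf cg fg; apply: le_Rintegral => //; exact: continuous_integrable.
Qed.

Lemma eq_sint f g a b : (forall x, a <= x <= b -> f x = g x) ->
  sint f a b = sint g a b.
Proof.
by move=> fg; apply: eq_Rintegral => x; rewrite inE /= in_itv /=; exact: fg.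
Qed.

Lemma sint_near f k e a b : continuous f -> a <= b ->
  (forall x, a <= x <= b -> `|f x - k| <= e) ->
  `|sint f a b - k * (b - a)| <= e * (b - a).
Proof.
move=> cf ab fk; have ck l : continuous (fun _ : R => l : R) by move=> ?; exact: cvg_cst.
rewrite ler_distl -mulrBl -mulrDl -!(sint_cst _ ab); apply/andP; split;
  apply: sint_le => // x /fk; rewrite ler_distl => /andP[] //.
Qed.

End segment_integral.

Lemma nested_intervals {R : realType} (x l : nat -> R) :
  (forall n, x n <= x n.+1) -> (forall n, x n.+1 + l n.+1 <= x n + l n) ->
  (forall n, 0 <= l n) -> exists c, forall n, x n <= c <= x n + l n.
Proof.
move=> x_incr xl_decr l_ge0.
have xm m n : (m <= n)%N -> x m <= x n.
  by move=> /subnK <-; elim: (n - m)%N => // k /le_trans; apply; rewrite addSn.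
have xlm m n : (m <= n)%N -> x n + l n <= x m + l m.
  by move=> /subnK <-; elim: (n - m)%N => // k; apply: le_trans; rewrite addSn.
have x_le m n : x m <= x n + l n.
  have [mn|nm] := leqP m n; first by rewrite (le_trans (xm _ _ mn)) // lerDl.
  by rewrite (le_trans _ (xlm _ _ (ltnW nm))) // lerDl.
exists (sup (range x)) => n; apply/andP; split.
  by apply: ub_le_sup; [exists (x 0%N + l 0%N) => _ [m _ <-]|exists n].
by apply: ge_sup; [exists (x 0%N), 0%N|move=> _ [m _ <-]].
Qed.

Section goursat.
Context {R : realType}.

(* Pointwise (Frechet) form of the first half of the Cauchy-Riemann
   equations, [dp/du = dq/dv]. *)
Definition conj_diff (p q : R -> R -> R) (u v : R) := exists A B C : R,
  forall e, 0 < e -> exists2 d, 0 < d & forall a b, `|a| < d -> `|b| < d ->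
    `|p (u + a) (v + b) - p u v - (A * a + B * b)| <= e * (`|a| + `|b|) /\
    `|q (u + a) (v + b) - q u v - (C * a + A * b)| <= e * (`|a| + `|b|).

Context (p q : R -> R -> R).
Hypothesis p_cont : forall u, continuous (p u).
Hypothesis q_cont : forall v, continuous (q ^~ v).

(** The counterclockwise integral of [q du + p dv] along the boundary of the rectangle: the
    imaginary part of the contour integral of [p + i q]. *)
Let flux u1 u2 v1 v2 : R :=
  sint (p u2) v1 v2 - sint (p u1) v1 v2
  - (sint (q ^~ v2) u1 u2 - sint (q ^~ v1) u1 u2).

(** The affine approximations contribute [A * l1 * l2] through [p] and the same amount through [q].
    These cancel, since the coefficient [A] is shared, and only the remainders are left. *)
Let flux_near u v l1 l2 c d A B C e :
  u <= c <= u + l1 -> v <= d <= v + l2 -> 0 <= e ->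
  (forall a b, `|a| <= l1 -> `|b| <= l2 ->
    `|p (c + a) (d + b) - p c d - (A * a + B * b)| <= e * (`|a| + `|b|) /\
    `|q (c + a) (d + b) - q c d - (C * a + A * b)| <= e * (`|a| + `|b|)) ->
  `|flux u (u + l1) v (v + l2)| <= 2 * e * (l1 + l2) ^+ 2.
Proof.
move=> /andP[uc cu] /andP[vd dv] e0 H.
have l1_ge0 : 0 <= l1 by lra. have l2_ge0 : 0 <= l2 by lra.
have dist_le (x y l z : R) : x <= y <= x + l -> x <= z <= x + l -> `|z - y| <= l.
  by move=> /andP[? ?] /andP[? ?]; rewrite ler_norml; apply/andP; split; lra.
have Hp x y : u <= x <= u + l1 -> v <= y <= v + l2 ->
    `|p x y - p c d - (A * (x - c) + B * (y - d))| <= e * (l1 + l2) /\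
    `|q x y - q c d - (C * (x - c) + A * (y - d))| <= e * (l1 + l2).
  move=> xu yv.
  have xc : `|x - c| <= l1 by apply: (dist_le u) => //; rewrite uc.
  have yd : `|y - d| <= l2 by apply: (dist_le v) => //; rewrite vd.
  have := H _ _ xc yd; rewrite (addrC c) subrK (addrC d) subrK => -[h1 h2].
  have le12 : e * (`|x - c| + `|y - d|) <= e * (l1 + l2) by rewrite ler_wpM2l // lerD.
  by split; [exact: le_trans h1 _|exact: le_trans h2 _].
have h1 : `|sint (p (u + l1)) v (v + l2) - sint (p u) v (v + l2) - A * l1 * l2|
   <= 2 * e * (l1 + l2) * l2.
  rewrite -sintB // -[X in _ - _ * X](addKr v) [- v + _]addrC.
  rewrite -[X in _ <= _ * X](addKr v) [- v + _ in leRHS]addrC.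
  apply: sint_near => [y||y yv].
  - by apply: cvgB; exact: p_cont.
  - by rewrite lerDl.
  - have [|+ _] := Hp u y _ yv; first by rewrite lexx lerDl.
    have [|+ _] := Hp (u + l1) y _ yv; first by rewrite lexx lerDl l1_ge0.
    rewrite !ler_norml; move=> /andP[? ?] /andP[? ?]; apply/andP; split; lra.
have h2 : `|sint (q ^~ (v + l2)) u (u + l1) - sint (q ^~ v) u (u + l1) - A * l2 * l1|
   <= 2 * e * (l1 + l2) * l1.
  rewrite -sintB // -[X in _ - _ * X](addKr u) [- u + _]addrC.
  rewrite -[X in _ <= _ * X](addKr u) [- u + _ in leRHS]addrC.
  apply: sint_near => [y||y yv].
  - by apply: cvgB; exact: q_cont.
  - by rewrite lerDl.
  - have [|_ +] := Hp y v yv _; first by rewrite lexx lerDl.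
    have [|_ +] := Hp y (v + l2) yv _; first by rewrite lexx lerDl l2_ge0.
    rewrite !ler_norml; move=> /andP[? ?] /andP[? ?]; apply/andP; split; lra.
rewrite /flux; move: h1 h2; rewrite !ler_norml => /andP[? ?] /andP[? ?].
by apply/andP; split; lra.
Qed.

Let quarters u v l1 l2 : 0 <= l1 -> 0 <= l2 ->
  flux u (u + l1 * 2) v (v + l2 * 2) =
   flux u (u + l1) v (v + l2) + flux (u + l1) (u + l1 + l1) v (v + l2) +
  (flux u (u + l1) (v + l2) (v + l2 + l2)
   + flux (u + l1) (u + l1 + l1) (v + l2) (v + l2 + l2)).
Proof.
move=> l1_ge0 l2_ge0; rewrite /flux !mulr_natr !mulr2n !addrA.
have split1 f : continuous f -> sint f u (u + l1 + l1) =
    sint f u (u + l1) + sint f (u + l1) (u + l1 + l1).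
  by move=> cf; apply: sint_split; rewrite ?lerDl.
have split2 f : continuous f -> sint f v (v + l2 + l2) =
    sint f v (v + l2) + sint f (v + l2) (v + l2 + l2).
  by move=> cf; apply: sint_split; rewrite ?lerDl.
by rewrite !split1 // !split2 //; ring.
Qed.

Let quarter u v l1 l2 : 0 <= l1 -> 0 <= l2 ->
  exists b : bool * bool,
  let u' := u + b.1%:R * l1 in let v' := v + b.2%:R * l2 in
  `|flux u (u + l1 * 2) v (v + l2 * 2)| <= 4 * `|flux u' (u' + l1) v' (v' + l2)|.
Proof.
move=> l1_ge0 l2_ge0; rewrite quarters //.
set f00 := flux u _ v _; set f10 := flux (u + l1) _ v _.
set f01 := flux u _ (v + l2) _; set f11 := flux (u + l1) _ (v + l2) _.
apply: contrapT => /forallNP Hn.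
have /negP := Hn (false, false); have /negP := Hn (true, false).
have /negP := Hn (false, true); have /negP := Hn (true, true).
rewrite /= !mul0r !mul1r !addr0 -/f00 -/f10 -/f01 -/f11 -!ltNge.
have := ler_normD (f00 + f10) (f01 + f11).
have := ler_normD f00 f10; have := ler_normD f01 f11.
lra.
Qed.

(** Bisection: a nonzero flux of modulus [K] leaves at least [K / 4 ^+ n] on some rectangle of
    generation [n], while differentiability at the common point of the nested rectangles gives
    [o(1 / 4 ^+ n)]. *)
Theorem goursat_rectangle u1 u2 v1 v2 : u1 <= u2 -> v1 <= v2 ->
  (forall u v, u1 <= u <= u2 -> v1 <= v <= v2 -> conj_diff p q u v) ->
  sint (p u2) v1 v2 - sint (p u1) v1 v2 =
  sint (q ^~ v2) u1 u2 - sint (q ^~ v1) u1 u2.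
Proof.
move=> u12 v12 pq; apply/eqP; rewrite -subr_eq0 -/(flux _ _ _ _) -normr_eq0.
rewrite eq_le normr_ge0 andbT leNgt; apply/negP => K0.
set K := `|_| in K0.
pose l1 n : R := (u2 - u1) / 2 ^+ n; pose l2 n : R := (v2 - v1) / 2 ^+ n.
have l1S n : l1 n = l1 n.+1 * 2 by rewrite /l1 exprSr invfM mulrA mulfVK.
have l2S n : l2 n = l2 n.+1 * 2 by rewrite /l2 exprSr invfM mulrA mulfVK.
have l1_ge0 n : 0 <= l1 n by rewrite divr_ge0 ?subr_ge0 // exprn_ge0.
have l2_ge0 n : 0 <= l2 n by rewrite divr_ge0 ?subr_ge0 // exprn_ge0.
pose next n (w : R * R) (b : bool * bool) :=
  (w.1 + b.1%:R * l1 n.+1, w.2 + b.2%:R * l2 n.+1).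
pose F n (w : R * R) := `|flux w.1 (w.1 + l1 n) w.2 (w.2 + l2 n)|.
have /choice[sel selP] (nw : nat * (R * R)) :
    exists b, F nw.1 nw.2 <= 4 * F nw.1.+1 (next nw.1 nw.2 b).
  case: nw => n w /=; rewrite /F (l1S n) (l2S n).
  by have [b] := quarter w.1 w.2 (l1_ge0 n.+1) (l2_ge0 n.+1); exists b.
pose fix w n := if n is m.+1 then next m (w m) (sel (m, w m)) else (u1, v1).
have wF n : K <= 4 ^+ n * F n (w n).
  elim: n => [|n IH].
    by rewrite /F /K /= /l1 /l2 expr0 mul1r !divr1 !(addrC _ (_ - _)) !subrK.
  rewrite (le_trans IH) // exprSr -mulrA ler_wpM2l ?exprn_ge0 //.
  exact: (selP (n, w n)).
have b01 (b : bool) (l : R) : 0 <= l -> 0 <= b%:R * l <= l.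
  by move=> l0; case: b; rewrite ?mul1r ?mul0r ?lexx l0.
have [|||c cP] := @nested_intervals R (fun n => (w n).1) l1 => //.
- by move=> n /=; rewrite lerDl; case/andP: (b01 (sel (n, w n)).1 _ (l1_ge0 n.+1)).
- move=> n /=; rewrite (l1S n); case/andP: (b01 (sel (n, w n)).1 _ (l1_ge0 n.+1)); lra.
have [|||d dP] := @nested_intervals R (fun n => (w n).2) l2 => //.
- by move=> n /=; rewrite lerDl; case/andP: (b01 (sel (n, w n)).2 _ (l2_ge0 n.+1)).
- move=> n /=; rewrite (l2S n); case/andP: (b01 (sel (n, w n)).2 _ (l2_ge0 n.+1)); lra.
have [||A [B [C ABC]]] := pq c d.
- by have := cP 0%N; rewrite /= /l1 expr0 divr1 addrC subrK.
- by have := dP 0%N; rewrite /= /l2 expr0 divr1 addrC subrK.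
pose S := (u2 - u1) + (v2 - v1).
have S_ge0 : 0 <= S by rewrite /S; lra.
have S2 : 0 < 4 * (S ^+ 2 + 1) by have := sqr_ge0 S; lra.
(* [flux_near] yields [2 * e * S ^+ 2 / 4 ^+ n], which this choice of [e] puts strictly below
   [K / 4 ^+ n]; the summand 1 covers a degenerate rectangle. *)
have e0 : 0 < K / (4 * (S ^+ 2 + 1)) by rewrite divr_gt0.
have [del del0 Hd] := ABC _ e0.
have [n nP] : exists n, l1 n < del /\ l2 n < del.
  have [n Sn] : exists n, S / del < 2 ^+ n.
    exists (Num.bound (S / del)); apply: lt_le_trans (archi_boundP _) _.
      by rewrite divr_ge0 // ltW.
    by rewrite -natrX ler_nat ltnW // ltn_expl.
  exists n; rewrite ltr_pdivrMr // in Sn.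
  by rewrite /l1 /l2 !ltr_pdivrMr ?exprn_gt0 // !(mulrC del); rewrite /S in Sn; lra.
have := wF n; rewrite leNgt => /negP; apply.
apply: (@le_lt_trans _ _ (4 ^+ n * (2 * (K / (4 * (S ^+ 2 + 1))) * (l1 n + l2 n) ^+ 2))).
  rewrite ler_wpM2l ?exprn_ge0 //; apply: (flux_near (cP n) (dP n) (ltW e0)) => a b al bl.
  by apply: Hd; [exact: le_lt_trans al nP.1|exact: le_lt_trans bl nP.2].
have -> : l1 n + l2 n = S / 2 ^+ n by rewrite /l1 /l2 -mulrDl.
have -> : (4 : R) ^+ n = (2 ^+ n) ^+ 2 by rewrite -exprM mulnC exprM expr2 -natrM.
rewrite exprMn exprVn; set X := (2 ^+ n) ^+ 2.
have X0 : X != 0 by rewrite !expf_neq0.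
have -> : X * (2 * (K / (4 * (S ^+ 2 + 1))) * (S ^+ 2 / X)) =
   K * (2 * S ^+ 2) / (4 * (S ^+ 2 + 1)) by field; rewrite X0 /=; have := sqr_ge0 S; lra.
by rewrite ltr_pdivrMr // ltr_pM2l //; have := sqr_ge0 S; lra.
Qed.

End goursat.

(** * Complex numbers and complex differentiability *)

Section complex_modulus.
Import Normc.
Context {R : realType}.
Implicit Types (z w : Cx R) (a b : R).

Lemma cabsE z : cabs z = normc z. Proof. by case: z. Qed.
Lemma normr_cabs z : `|z| = (cabs z)%:C%C :> R[i]. Proof. by rewrite normc_def. Qed.
Lemma cabsM z w : cabs (z * w) = cabs z * cabs w.
Proof. by rewrite !cabsE normcM. Qed.
Lemma cabsV z : cabs z^-1 = (cabs z)^-1.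
Proof. by rewrite !cabsE normcV. Qed.
Lemma cabsD z w : cabs (z + w) <= cabs z + cabs w.
Proof. by rewrite !cabsE le_normcD. Qed.
Lemma cabsN z : cabs (- z) = cabs z.
Proof. by rewrite !cabsE normcN. Qed.
Lemma cabsB z w : cabs (z - w) = cabs (w - z).
Proof. by rewrite -cabsN opprB. Qed.
Lemma cabs_ge0 z : 0 <= cabs z. Proof. exact: sqrtr_ge0. Qed.
Lemma cabs0 : cabs (0 : Cx R) = 0. Proof. by rewrite cabsE normc0. Qed.
Lemma cabs1 : cabs (1 : Cx R) = 1. Proof. by rewrite cabsE normc1. Qed.
Lemma cabs_eq0 z : (cabs z == 0) = (z == 0).
Proof.
apply/eqP/eqP => [|->]; last exact: cabs0.
by rewrite cabsE => /eq0_normc.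
Qed.
Lemma cabsX z n : cabs (z ^+ n) = cabs z ^+ n.
Proof. by elim: n => [|n IH]; rewrite ?expr0 ?cabs1 // !exprS cabsM IH. Qed.
Lemma cabs_cR a : cabs (cR a) = `|a|.
Proof. by rewrite /cabs /cabs2 /= expr0n addr0 sqrtr_sqr. Qed.
Lemma sqr_cabs z : cabs z ^+ 2 = complex.Re z ^+ 2 + complex.Im z ^+ 2.
Proof. by rewrite sqr_sqrtr // addr_ge0 // sqr_ge0. Qed.
Lemma ler_Re_cabs z : `|complex.Re z| <= cabs z.
Proof. by rewrite -sqrtr_sqr ler_sqrt ?lerDl ?addr_ge0 ?sqr_ge0. Qed.
Lemma ler_Im_cabs z : `|complex.Im z| <= cabs z.
Proof. by rewrite -sqrtr_sqr ler_sqrt ?lerDr ?addr_ge0 ?sqr_ge0. Qed.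
Lemma cabs_le a b : cabs (Complex a b) <= `|a| + `|b|.
Proof.
rewrite -(@ler_pXn2r _ 2) ?nnegrE ?cabs_ge0 ?addr_ge0 // sqr_cabs /=.
rewrite sqrrD !real_normK ?num_real // addrAC lerDl.
by rewrite mulrn_wge0 // mulr_ge0.
Qed.

Lemma ReD z w : complex.Re (z + w) = complex.Re z + complex.Re w.
Proof. by case: z; case: w. Qed.
Lemma Re_cRM a z : complex.Re (cR a * z) = a * complex.Re z.
Proof. by case: z => c d; rewrite /= mul0r subr0. Qed.
Lemma cRD a b : cR a + cR b = cR (a + b).
Proof. by apply/eqP; rewrite eq_complex /= addr0 !eqxx. Qed.
Lemma cRM a b : cR a * cR b = cR (a * b).
Proof. by apply/eqP; rewrite eq_complex /= !(mulr0, mul0r, subr0, addr0) !eqxx. Qed.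
Lemma cRV a : a != 0 -> (cR a)^-1 = cR a^-1.
Proof.
move=> a0; have ca0 : cR a != 0 by rewrite -cabs_eq0 cabs_cR normr_eq0.
by apply: (mulfI ca0); rewrite mulfV // cRM mulfV.
Qed.
Lemma cRX a n : cR a ^+ n = cR (a ^+ n).
Proof. by elim: n => [|n IH]; rewrite ?expr0 // !exprS IH cRM. Qed.

End complex_modulus.

Section complex_topology.
Context {R : realType}.

(** The norm of [Cx R] takes values in [R[i]], so its epsilons are complex. Positivity forces their
    imaginary part to vanish, which allows real epsilons throughout. *)
Lemma cvg_cabsP {T : Type} {F : set_system T} {FF : Filter F} (f : T -> Cx R) (l : Cx R) :
  f @ F --> l <-> forall e : R, 0 < e -> \forall x \near F, cabs (f x - l) < e.
Proof.
split=> [/cvgrPdist_lt fl e e0|fl].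
  have := fl (e%:C)%C; rewrite ltcR => /(_ e0) H.
  by apply: (filterS _ H) => x; rewrite normr_cabs ltcR cabsB.
apply/cvgrPdist_lt => -[e e'] /=; rewrite ltcE /= => /andP[/eqP -> e0].
by apply: (filterS _ (fl _ e0)) => x; rewrite normr_cabs cabsB ltcR.
Qed.

Lemma cvg_Re {T : Type} {F : set_system T} {FF : Filter F} (f : T -> Cx R) (l : Cx R) :
  f @ F --> l -> complex.Re (f x) @[x --> F] --> complex.Re l.
Proof.
move=> /cvg_cabsP fl; apply/cvgrPdist_lt => e /fl H; apply: (filterS _ H) => x.
by apply: le_lt_trans; rewrite distrC -raddfB; exact: (ler_Re_cabs (f x - l)).
Qed.

Lemma cvg_Im {T : Type} {F : set_system T} {FF : Filter F} (f : T -> Cx R) (l : Cx R) :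
  f @ F --> l -> complex.Im (f x) @[x --> F] --> complex.Im l.
Proof.
move=> /cvg_cabsP fl; apply/cvgrPdist_lt => e /fl H; apply: (filterS _ H) => x.
by apply: le_lt_trans; rewrite distrC -raddfB; exact: (ler_Im_cabs (f x - l)).
Qed.

Lemma cvg_Complex {T : Type} {F : set_system T} {FF : Filter F} (f g : T -> R) (l m : R) :
  f @ F --> l -> g @ F --> m -> (Complex (f x) (g x) : Cx R) @[x --> F] --> (Complex l m : Cx R).
Proof.
move=> /cvgrPdist_lt fl /cvgrPdist_lt gm; apply/cvg_cabsP => e e0.
have e20 : 0 < e / 2 by lra.
near=> x; apply: (@le_lt_trans _ _ (`|f x - l| + `|g x - m|)); first exact: cabs_le.
rewrite (splitr e) ltrD // distrC.
  by near: x; exact: fl.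
by near: x; exact: gm.
Unshelve. all: by end_near. Qed.

Lemma derivable_cabs (f : Cx R -> Cx R) (z : Cx R) : derivable f z 1 ->
  exists D : Cx R, forall e : R, 0 < e -> exists2 d : R, 0 < d &
  forall w, cabs w < d -> cabs (f (z + w) - f z - D * w) <= e * cabs w.
Proof.
move=> /cvg_ex[/= D]; move=> /cvg_cabsP HD; exists D => e e0.
have [/= [d d'] /=] := HD _ e0; rewrite ltcE /= => /andP[/eqP -> d0 Hd].
exists d => // w wd; have [->|w0] := eqVneq w 0.
  by rewrite addr0 subrr mulr0 subr0 cabs0 mulr0.
have := Hd w; rewrite /= sub0r normrN normr_cabs ltcR => /(_ wd w0).
rewrite [w *: _]mulr1 (addrC w) => /ltW.
have -> : w^-1 *: (f (z + w) - f z) - D = (f (z + w) - f z - D * w) / w.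
  by rewrite mulrBl mulfK // mulrC.
by rewrite cabsM cabsV ler_pdivrMr // lt0r cabs_eq0 w0 cabs_ge0.
Qed.

Lemma cabs_derivable (f : Cx R -> Cx R) (z D : Cx R) :
  (forall e : R, 0 < e -> exists2 d : R, 0 < d &
    forall w, cabs w < d -> cabs (f (z + w) - f z - D * w) <= e * cabs w) ->
  derivable f z 1.
Proof.
move=> HD; apply/cvg_ex; exists D; apply/cvg_cabsP => e e0.
have e20 : 0 < e / 2 by rewrite divr_gt0.
have [d d0 Hd] := HD _ e20.
exists (d%:C)%C; first by rewrite /= ltcR.
move=> w /=; rewrite sub0r normrN normr_cabs ltcR => wd w0.
apply: (@le_lt_trans _ _ (e / 2)); last by rewrite ltr_pdivrMr // ltr_pMr // ltr1n.
have -> : w^-1 *: (f (w *: 1 + z) - f z) - D = (f (z + w) - f z - D * w) / w.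
  by rewrite [w *: 1]mulr1 (addrC w) [in RHS]mulrBl mulfK // [in RHS]mulrC.
by rewrite cabsM cabsV ler_pdivrMr ?Hd // lt0r cabs_eq0 w0 cabs_ge0.
Qed.

Implicit Types (F G : Cx R -> Cx R) (z : Cx R).

(* The general rules do not unify in reasonable time at the type [Cx R]. *)
Lemma derivable_mulC F G z : derivable F z 1 -> derivable G z 1 ->
  derivable (fun z => F z * G z) z 1.
Proof. exact (@derivableM (complex R) (Cx R) F G z 1). Qed.

Lemma derivable_subC F G z : derivable F z 1 -> derivable G z 1 ->
  derivable (fun z => F z - G z) z 1.
Proof. exact (@derivableB (complex R) (Cx R) (Cx R) F G z 1). Qed.

Lemma derivable_addC F G z : derivable F z 1 -> derivable G z 1 ->
  derivable (fun z => F z + G z) z 1.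
Proof. exact (@derivableD (complex R) (Cx R) (Cx R) F G z 1). Qed.

Lemma derivable_invC F z : F z != 0 -> derivable F z 1 ->
  derivable (fun z => (F z)^-1) z 1.
Proof. exact (@derivableV (complex R) (Cx R) F z 1). Qed.

Lemma derivable_cstC (c z : Cx R) : derivable (fun=> c : Cx R) z 1.
Proof. exact (@derivable_cst (complex R) (Cx R) (Cx R) c z 1). Qed.

Lemma derivable_idC z : derivable (fun z => z : Cx R) z 1.
Proof. exact (@derivable_id (complex R) (Cx R) z 1). Qed.

Lemma derivable_expC F n z : derivable F z 1 -> derivable (fun z => F z ^+ n) z 1.
Proof.
move=> dF; elim: n => [|n IH]; first exact: derivable_cstC.
by under eq_fun do rewrite exprS; exact: derivable_mulC.
Qed.

Lemma derivable_compC F G z : derivable F (G z) 1 -> derivable G z 1 ->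
  derivable (fun z => F (G z)) z 1.
Proof.
move=> /derivable_cabs[D HD] /derivable_cabs[E HE]; apply: (@cabs_derivable _ _ (D * E)) => e e0.
have [D1 E1] : 0 < cabs D + 1 /\ 0 < cabs E + 1.
  by split; apply: ltr_wpDl; rewrite ?cabs_ge0.
have e2 : 0 < e / 2 / (cabs E + 1) by rewrite !divr_gt0.
(* The cap at 1 bounds the increment [k] of [G] by [(cabs E + 1) * cabs w], which is what the
   estimate for [F] is applied to. *)
have e1 : 0 < Num.min 1 (e / 2 / (cabs D + 1)) by rewrite lt_min ltr01 !divr_gt0.
have [d2 d20 H2] := HD _ e2; have [d1 d10 H1] := HE _ e1.
exists (Num.min d1 (d2 / (cabs E + 1))) => [|w]; first by rewrite lt_min d10 divr_gt0.
rewrite lt_min => /andP[/H1 Hk wd2]; pose k := G (z + w) - G z.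
have Hk1 : cabs (k - E * w) <= cabs w.
  by apply: le_trans Hk _; rewrite ler_piMl ?cabs_ge0 // ge_min lexx.
have kw : cabs k <= (cabs E + 1) * cabs w.
  rewrite -[k](subrK (E * w)) (le_trans (cabsD _ _)) // cabsM mulrDl mul1r addrC.
  by rewrite lerD2l.
have kd : cabs k < d2 by rewrite (le_lt_trans kw) // mulrC -ltr_pdivlMr.
have -> : F (G (z + w)) - F (G z) - D * E * w =
    (F (G z + k) - F (G z) - D * k) + D * (k - E * w).
  by rewrite /k [G z + _]addrC subrK; ring.
rewrite (le_trans (cabsD _ _)) // (splitr e) mulrDl cabsM lerD //.
  apply: le_trans (H2 _ kd) _; rewrite -mulrA; apply: ler_wpM2l; first by rewrite divr_ge0 // ltW.
  by rewrite mulrC ler_pdivrMr // mulrC.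
apply: (@le_trans _ _ (cabs D * (e / 2 / (cabs D + 1) * cabs w))).
  rewrite ler_wpM2l ?cabs_ge0 // (le_trans Hk) // ler_wpM2r ?cabs_ge0 //.
  by rewrite ge_min lexx orbT.
rewrite mulrA ler_wpM2r ?cabs_ge0 // mulrA ler_pdivrMr // mulrC.
by rewrite ler_wpM2l ?lerDl // divr_ge0 // ltW.
Qed.

End complex_topology.

(** * Logarithmic polar coordinates *)

Section polar.
Context {R : realType}.
Implicit Types (s u v a b e d : R).

Definition polar s v : Cx R := Complex (s * cos v) (s * sin v).

Lemma cabs_polar s v : cabs (polar s v) = `|s|.
Proof. by rewrite /cabs /cabs2 /= !exprMn -mulrDr cos2Dsin2 mulr1 sqrtr_sqr. Qed.

Lemma polarM s u v w : polar s v * polar u w = polar (s * u) (v + w).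
Proof.
have mulCx (a b c d : R) :
  (Complex a b : Cx R) * Complex c d = Complex (a * c - b * d) (a * d + b * c) by [].
by rewrite /polar mulCx cosD sinD; congr Complex; ring.
Qed.

Lemma polar_2pi s : polar s (2 * pi) = polar s 0.
Proof. by rewrite /polar mulr_natl cos2pi sin2pi cos0 sin0. Qed.

Lemma is_derive_lin (f : R -> R) (x D : R) : is_derive x 1 f D ->
  forall e : R, 0 < e -> exists2 d : R, 0 < d & forall a : R, `|a| < d ->
    `|f (x + a) - f x - D * a| <= e * `|a|.
Proof.
move=> [/cvg_ex[l fl] fD] e e0; have lD : l = D by rewrite -fD; apply/esym/cvg_lim.
move: fl => /cvgrPdist_le/(_ e e0) [/= d d0 Hd]; exists d => // a ad.
have [->|a0] := eqVneq a 0; first by rewrite addr0 subrr mulr0 subr0 normr0 mulr0.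
have := Hd a; rewrite /= sub0r normrN => /(_ ad a0).
rewrite lD [a *: _]mulr1 (addrC a) => h.
rewrite -ler_pdivrMr ?normr_gt0 //; apply: le_trans h.
by rewrite distrC -normfV -normrM mulrBl mulfK // (mulrC _ a^-1).
Qed.

(** The first-order expansion of the complex exponential at 0, assembled from those of [expR], [cos]
    and [sin]. *)
Lemma polar_near1 e : 0 < e -> exists2 d, 0 < d & forall a b, `|a| < d -> `|b| < d ->
  cabs (polar (expR a) b - 1 - Complex a b) <= e * (`|a| + `|b|).
Proof.
move=> e0; pose e' := Num.min (e / 16) 1.
have e'0 : 0 < e' by rewrite lt_min ltr01 andbT divr_gt0.
have [e'e e'1] : e' <= e / 16 /\ e' <= 1 by rewrite /e' !ge_min !lexx orbT.
have [d1 d10 H1] := is_derive_lin (is_derive_expR 0) e'0.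
have [d2 d20 H2] := is_derive_lin (is_derive_cos 0) e'0.
have [d3 d30 H3] := is_derive_lin (is_derive_sin 0) e'0.
exists (Num.min (Num.min (Num.min d1 1) (e / 8)) (Num.min d2 d3)) => [|a b].
  by rewrite !lt_min d10 d20 d30 ltr01 divr_gt0.
rewrite !lt_min => /andP[/andP[/andP[ad1 a1] ad8] _] /andP[_ /andP[bd2 bd3]].
have := H1 _ ad1; have := H2 _ bd2; have := H3 _ bd3.
rewrite !add0r expR0 cos0 sin0 oppr0 mul0r !(subr0, addr0) !mul1r => hs hc he.
have ea : `|expR a| <= 1 + 2 * `|a|.
  have -> : expR a = (expR a - 1 - a) + (1 + a) by ring.
  apply: le_trans (ler_normD _ _) _; have := ler_normD 1 a; rewrite normr1.
  have := ler_wpM2r (normr_ge0 a) e'1; lra.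
have ea1 : `|expR a - 1| <= 2 * `|a|.
  have -> : expR a - 1 = (expR a - 1 - a) + a by ring.
  apply: le_trans (ler_normD _ _) _.
  have := ler_wpM2r (normr_ge0 a) e'1; lra.
have -> : polar (expR a) b - 1 - Complex a b =
    Complex (expR a * cos b - 1 - a) (expR a * sin b - 0 - b) by [].
apply: le_trans (cabs_le _ _) _.
have -> : expR a * cos b - 1 - a = expR a * (cos b - 1 - 0) + (expR a - 1 - a) by ring.
have -> : expR a * sin b - 0 - b = expR a * (sin b - b) + (expR a - 1) * b by ring.
have h1 : `|expR a * (cos b - 1 - 0)| <= 3 * (e' * `|b|).
  by rewrite subr0 normrM ler_pM //; lra.
have h2 : `|expR a * (sin b - b)| <= 3 * (e' * `|b|).
  by rewrite normrM ler_pM //; lra.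
have h3 : `|(expR a - 1) * b| <= 2 * (e / 8) * `|b|.
  by rewrite normrM ler_wpM2r //; lra.
apply: le_trans (lerD (ler_normD _ _) (ler_normD _ _)) _.
have h4 : e' * `|a| <= e / 16 * `|a| by rewrite ler_wpM2r.
have h5 : e' * `|b| <= e / 16 * `|b| by rewrite ler_wpM2r.
have := mulr_ge0 (ltW e0) (normr_ge0 a); have := mulr_ge0 (ltW e0) (normr_ge0 b).
lra.
Qed.

(** In the coordinate [u + i v = log z] the differential of [F] is multiplication by [E = z * D],
    whose real matrix has equal diagonal entries. *)
Lemma conj_diff_polar (F : Cx R -> Cx R) u v :
  derivable F (polar (expR u) v) 1 ->
  conj_diff (fun u v => complex.Re (F (polar (expR u) v)))
            (fun u v => complex.Im (F (polar (expR u) v))) u v.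
Proof.
set z := polar (expR u) v => /derivable_cabs[D HD].
pose E := z * D; exists (complex.Re E), (- complex.Im E), (complex.Im E) => e e0.
pose C := cabs z + cabs z * cabs D + 1.
have C0 : 0 < C by rewrite /C; have := cabs_ge0 z; have := mulr_ge0 (cabs_ge0 z) (cabs_ge0 D); lra.
have [d1 d10 H1] := HD _ (divr_gt0 e0 (mulr_gt0 (ltr0Sn R 3) C0)).
have e10 : 0 < Num.min (e / (4 * C)) 1 by rewrite lt_min ltr01 andbT divr_gt0 // mulr_gt0.
have [d2 d20 H2] := polar_near1 e10.
exists (Num.min d2 (d1 / (4 * C))) => [|a b].
  by rewrite lt_min d20 divr_gt0 // mulr_gt0.
rewrite !lt_min => /andP[a2 a1] /andP[b2 b1].
set n := `|a| + `|b|.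
have n_ge0 : 0 <= n by rewrite addr_ge0.
pose w := z * (polar (expR a) b - 1).
have zw : z + w = polar (expR (u + a)) (v + b).
  by rewrite /w mulrBr mulr1 addrC subrK polarM expRD.
have := H2 _ _ a2 b2; rewrite -/n => Hw.
have Hw1 : cabs (polar (expR a) b - 1 - Complex a b) <= n.
  by apply: le_trans Hw _; rewrite -[leRHS]mul1r ler_wpM2r // ge_min lexx orbT.
have Hwe : cabs (polar (expR a) b - 1 - Complex a b) <= e / (4 * C) * n.
  by apply: le_trans Hw _; rewrite ler_wpM2r // ge_min lexx.
have wn : cabs w <= cabs z * (2 * n).
  rewrite /w cabsM ler_wpM2l ?cabs_ge0 //.
  rewrite -[polar _ _ - 1](subrK (Complex a b)); apply: le_trans (cabsD _ _) _.
  have := cabs_le a b; rewrite -/n; lra.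
have wd1 : cabs w < d1.
  apply: le_lt_trans wn _.
  have : n < 2 * (d1 / (4 * C)) by rewrite /n; lra.
  rewrite mulrA ltr_pdivlMr ?mulr_gt0 //.
  have : cabs z * n <= C * n by rewrite ler_wpM2r // /C; have := mulr_ge0 (cabs_ge0 z) (cabs_ge0 D); lra.
  lra.
have key : cabs (F (z + w) - F z - E * Complex a b) <= e * n.
  have -> : F (z + w) - F z - E * Complex a b =
    (F (z + w) - F z - D * w) + E * (polar (expR a) b - 1 - Complex a b).
    by rewrite /w /E; ring.
  apply: le_trans (cabsD _ _) _; rewrite cabsM.
  have h1 : cabs (F (z + w) - F z - D * w) <= e / (4 * C) * (cabs z * (2 * n)).
    apply: le_trans (H1 _ wd1) _; rewrite ler_wpM2l // divr_ge0 ?ltW //.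
    by rewrite mulr_gt0.
  have h2 : cabs E * cabs (polar (expR a) b - 1 - Complex a b) <=
      cabs z * cabs D * (e / (4 * C) * n).
    by rewrite /E cabsM ler_wpM2l // mulr_ge0 ?cabs_ge0.
  have h3 : e * n = e / (4 * C) * n * (4 * C).
    by field; rewrite gt_eqF.
  have h4 : 0 <= e / (4 * C) * n by rewrite mulr_ge0 // divr_ge0 ?ltW // mulr_gt0.
  rewrite h3.
  have h5 : 2 * cabs z + cabs z * cabs D <= 4 * C.
    rewrite /C; have := cabs_ge0 z; have := mulr_ge0 (cabs_ge0 z) (cabs_ge0 D); lra.
  have := ler_wpM2l h4 h5; lra.
rewrite -zw; have kR := le_trans (ler_Re_cabs _) key; have kI := le_trans (ler_Im_cabs _) key.
have EE : E * Complex a b = Complex (complex.Re E * a - complex.Im E * b) (complex.Re E * b + complex.Im E * a).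
  by case: (E).
rewrite EE in kR kI; split.
  by rewrite mulNr; move: kR; case: (F (z + w)); case: (F z).
by rewrite [_ * a + _]addrC; move: kI; case: (F (z + w)); case: (F z).
Qed.

End polar.

(** * Circle averages and Laurent expansion *)

Section circle_average.
Context {R : realType}.
Implicit Types (s u v : R) (F G : Cx R -> Cx R).

Definition cavg F s : Cx R :=
  Complex (sint (fun v => complex.Re (F (polar s v))) 0 (2 * pi) / (2 * pi))
          (sint (fun v => complex.Im (F (polar s v))) 0 (2 * pi) / (2 * pi)).

Definition annulus s1 s2 : set (Cx R) := [set z | s1 <= cabs z <= s2].

Lemma continuous_fixl (p : R * R -> R) u : continuous p -> continuous (fun v => p (u, v)).
Proof.
move=> cp v; apply: (@cvg_comp2 _ _ _ _ (nbhs v) (nbhs u) (nbhs v) (nbhs (p (u, v))) _ _ _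
    (fun=> u) id (fun a b => p (a, b))); [exact: cvg_cst|exact: cvg_id|].
by rewrite (_ : (fun x => _) = p); [exact: (cp (u, v))|apply/funext => -[]].
Qed.

Lemma continuous_fixr (p : R * R -> R) v : continuous p -> continuous (fun u => p (u, v)).
Proof.
move=> cp u; apply: (@cvg_comp2 _ _ _ _ (nbhs u) (nbhs u) (nbhs v) (nbhs (p (u, v))) _ _ _
    id (fun=> v) (fun a b => p (a, b))); [exact: cvg_id|exact: cvg_cst|].
by rewrite (_ : (fun x => _) = p); [exact: (cp (u, v))|apply/funext => -[]].
Qed.

(** Compactness of the segment makes the continuity in [u] uniform in [v]. *)
Lemma continuous_sint (p : R * R -> R) (a b : R) : a <= b -> continuous p ->
  continuous (fun u => sint (fun v => p (u, v)) a b).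
Proof.
move=> ab cp u0.
have cpu := continuous_fixl cp.
apply/cvgrPdist_le => e e0.
have e'0 : 0 < e / (b - a + 1) by rewrite divr_gt0 //; lra.
have /compact_near_coveringP /(_ R (nbhs u0)
    (fun u v => `|p (u0, v) - p (u, v)| <= e / (b - a + 1))) H := @segment_compact R a b.
have : \forall u \near u0, `[a, b] `<=` (fun v => `|p (u0, v) - p (u, v)| <= e / (b - a + 1)).
  apply: H => v _.
  have /cvgrPdist_le := cp (u0, v); move=> /(_ (e / 2 / (b - a + 1))).
  have /cvgrPdist_le := cpu u0 v; move=> /(_ (e / 2 / (b - a + 1))).
  have e20 : 0 < e / 2 / (b - a + 1) by rewrite !divr_gt0 //; lra.
  move=> /(_ e20) H1 /(_ e20) [[A B] [/= nA nB] AB].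
  exists (B `&` [set v' | `|p (u0, v) - p (u0, v')| <= e / 2 / (b - a + 1)], A).
    by split=> //; exact: filterI.
  case=> v' u /= [[v'B v'1] uA].
  have -> : p (u0, v') - p (u, v') = (p (u0, v) - p (u, v')) - (p (u0, v) - p (u0, v')) by ring.
  have -> : e / (b - a + 1) = e / 2 / (b - a + 1) + e / 2 / (b - a + 1) by rewrite -mulrDl -splitr.
  by apply: le_trans (ler_normB _ _) _; apply: lerD => //; exact: (AB (u, v')).
move=> {}H; near=> u.
rewrite -sintB //.
have := @sint_near R (fun v => p (u0, v) - p (u, v)) 0 (e / (b - a + 1)) a b.
rewrite mul0r subr0 => /(_ _ ab) h; apply: le_trans (h _ _) _.
- by move=> v; apply: cvgB; exact: cpu.
- by move=> v vab; rewrite subr0; apply: (near H u) => //=; rewrite in_itv.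
- by rewrite -mulrA ler_piMr ?ltW // mulrC ltr_pdivrMr ?mul1r; lra.
Unshelve. all: by end_near. Qed.

Lemma continuous_within_comp {T : topologicalType} (D : set (Cx R)) F (c : T -> Cx R) :
  {within D, continuous F} -> continuous c -> (forall t, D (c t)) ->
  continuous (fun t => F (c t)).
Proof.
move=> /subspace_continuousP cF cc cD t.
apply: (@cvg_comp _ _ _ c F (nbhs t) (within D (nbhs (c t)))); last exact: cF.
move=> W HW; apply: (@filterS _ (nbhs t) _ _ (fun x => W (c x)) _ (cc t _ HW)).
by move=> x /(_ (cD x)).
Qed.

Lemma continuous_polar {T : topologicalType} (f g : T -> R) :
  continuous f -> continuous g -> continuous (fun t => polar (f t) (g t)).
Proof.
move=> cf cg t; apply: cvg_Complex.
  apply: (@cvgM _ _ _ _ f (fun x => cos (g x))); first exact: cf.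
  by apply: (continuous_comp (g := cos)); [exact: cg|exact: continuous_cos].
apply: (@cvgM _ _ _ _ f (fun x => sin (g x))); first exact: cf.
by apply: (continuous_comp (g := sin)); [exact: cg|exact: continuous_sin].
Qed.

Lemma circle_continuous s1 s2 s F : 0 < s1 -> s1 <= s <= s2 ->
  {within annulus s1 s2, continuous F} -> continuous (fun v => F (polar s v)).
Proof.
move=> s1_gt0 /andP[s1s ss2] cF; apply: (continuous_within_comp cF).
  by apply: continuous_polar => v; [exact: cvg_cst|exact: cvg_id].
by move=> v; rewrite /annulus /= cabs_polar ger0_norm ?s1s // ltW // (lt_le_trans s1_gt0).
Qed.

(** Goursat's theorem applies at radii strictly inside the annulus; this carries the equality of
    averages to the boundary circles, where [F] is merely continuous. *)
Lemma constant_closure (I : R -> R) (a b : R) : continuous I -> a <= b ->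
  (forall x y, a < x -> x <= y -> y < b -> I x = I y) -> I a = I b.
Proof.
move=> cI; rewrite le_eqVlt => /predU1P[-> //|ab] Iab.
pose m := (a + b) / 2; have am : a < m by rewrite /m; lra.
have mb : m < b by rewrite /m; lra.
have step x : (forall d, 0 < d -> exists2 u, `|x - u| < d & I u = I m) -> I x = I m.
  move=> xm; apply/eqP; rewrite -subr_eq0 -normr_eq0 eq_le normr_ge0 andbT.
  apply/ler_addgt0Pr => e e0; rewrite add0r.
  have /cvgrPdist_le/(_ e e0)[/= d d0 Hd] := cI x.
  by have [u xu <-] := xm d d0; apply: Hd.
transitivity (I m); [|symmetry]; apply: step => d d0.
- exists (Num.min m (a + d / 2)).
    have : Num.min m (a + d / 2) <= a + d / 2 by rewrite ge_min lexx orbT.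
    have : a < Num.min m (a + d / 2) by rewrite lt_min am /=; lra.
    by rewrite ltr_norml; move: (Num.min _ _) => u ? ?; apply/andP; split; lra.
  apply: Iab => //; last by rewrite ge_min lexx.
  by rewrite lt_min am /=; lra.
- exists (Num.max m (b - d / 2)).
    have : b - d / 2 <= Num.max m (b - d / 2) by rewrite le_max lexx orbT.
    have : Num.max m (b - d / 2) < b by rewrite gt_max mb /=; lra.
    by rewrite ltr_norml; move: (Num.max _ _) => u ? ?; apply/andP; split; lra.
  symmetry; apply: Iab => //; first by rewrite le_max lexx.
  by rewrite gt_max mb /=; lra.
Qed.

(** In the coordinates [(log radius, angle)] two circles are opposite sides of a rectangle, and the
    other two sides cancel because the angles 0 and [2 * pi] give the same points. *)
Lemma cavg_const s1 s2 F : 0 < s1 -> s1 <= s2 ->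
  {within annulus s1 s2, continuous F} ->
  (forall z, s1 < cabs z < s2 -> derivable F z 1) -> cavg F s1 = cavg F s2.
Proof.
move=> s1_gt0 s12 cF dF; have s2_gt0 := lt_le_trans s1_gt0 s12.
have pi2_ge0 : 0 <= 2 * pi :> R by rewrite mulr_ge0 // pi_ge0.
(* Clamping the radius makes the pullback of [F] continuous on the whole plane. *)
pose cl (u : R) : R := Num.max s1 (Num.min s2 (expR u)).
have cl_id u : s1 <= expR u <= s2 -> cl u = expR u.
  by move=> /andP[s1u us2]; rewrite /cl (min_idPr us2) (max_idPr s1u).
have cl_in u : s1 <= cl u <= s2.
  by rewrite /cl le_max lexx ge_max s12 ge_min lexx.
have ccl : continuous cl.
  move=> u; apply: (@continuous_max R R (fun=> s1) (fun u => Num.min s2 (expR u))).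
    exact: cvg_cst.
  apply: (@continuous_min R R (fun=> s2) expR); [exact: cvg_cst|exact: continuous_expR].
pose h (w : R * R) := F (polar (cl w.1) w.2).
have ch : continuous h.
  apply: (continuous_within_comp cF).
    apply: continuous_polar => w; last exact: cvg_snd.
    by apply: continuous_comp; [exact: cvg_fst|exact: ccl].
  move=> w; rewrite /annulus /= cabs_polar ger0_norm ?cl_in //.
  by rewrite (le_trans (ltW s1_gt0)) //; case/andP: (cl_in w.1).
have main (G : Cx R -> Cx R) (p q : R * R -> R) : continuous p -> continuous q ->
    (forall z, s1 < cabs z < s2 -> derivable G z 1) ->
    (forall w, p w = complex.Re (G (polar (cl w.1) w.2))) ->
    (forall w, q w = complex.Im (G (polar (cl w.1) w.2))) ->
    sint (fun v => p (ln s1, v)) 0 (2 * pi) = sint (fun v => p (ln s2, v)) 0 (2 * pi).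
  move=> cp cq dG pE qE.
  apply: (@constant_closure (fun u => sint (fun v => p (u, v)) 0 (2 * pi))).
  - exact: continuous_sint.
  - by rewrite ler_ln // posrE.
  move=> x y s1x xy ys2.
  have pq u v : x <= u <= y -> 0 <= v <= 2 * pi ->
      conj_diff (fun u v => p (u, v)) (fun u v => q (u, v)) u v.
    move=> /andP[xu uy] _.
    have s1u : ln s1 < u by exact: lt_le_trans xu.
    have us2 : u < ln s2 by exact: le_lt_trans ys2.
    have [|A [B [C H]]] := @conj_diff_polar _ G u v.
      apply: dG; rewrite cabs_polar ger0_norm ?expR_ge0 //.
      by rewrite -(lnK s1_gt0) -(lnK s2_gt0) !ltr_expR s1u.
    exists A, B, C => e /H[d d0 Hd].
    exists (Num.min d (Num.min (u - ln s1) (ln s2 - u))) => [|a b].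
      by rewrite !lt_min d0 !subr_gt0 s1u.
    rewrite !lt_min => /and3P[ad a1 a2] /andP[bd _].
    have clE c : `|c| < u - ln s1 -> `|c| < ln s2 - u -> cl (u + c) = expR (u + c).
      rewrite !ltr_norml => /andP[? _] /andP[_ ?]; apply: cl_id.
      rewrite -(lnK s1_gt0) -(lnK s2_gt0) !ler_expR.
      by apply/andP; split; lra.
    have := Hd _ _ ad bd; rewrite !pE !qE /= clE //.
    by have := clE 0; rewrite addr0 normr0 !subr_gt0 => ->.
  have := goursat_rectangle (fun u => continuous_fixl cp (u := u))
    (fun v => continuous_fixr cq (v := v))
    xy pi2_ge0 pq.
  rewrite [X in _ = X - _](@eq_sint _ _ (fun u => q (u, 0))) ?subrr.
    by move/eqP; rewrite subr_eq0 => /eqP.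
  by move=> u _; rewrite !qE /= polar_2pi.
rewrite /cavg.
have cl1 : cl (ln s1) = s1 by have := cl_id (ln s1); rewrite (lnK s1_gt0) lexx s12; exact.
have cl2 : cl (ln s2) = s2 by have := cl_id (ln s2); rewrite (lnK s2_gt0) lexx s12; exact.
have cRe : continuous (fun w => complex.Re (h w)) by move=> w; exact/cvg_Re/ch.
have cIm : continuous (fun w => complex.Im (h w)) by move=> w; exact/cvg_Im/ch.
have cNRe : continuous (fun w => - complex.Re (h w)) by move=> w; apply: cvgN; exact: cRe.
congr (Complex (_ / _) (_ / _)).
  have := main F _ _ cRe cIm dF (fun=> erefl) (fun=> erefl).
  by rewrite /h /= cl1 cl2.
(* Multiplication by [-i] turns the imaginary part of [F] into a real part, to which [main]
   applies. *)
have := main (fun z => (Complex 0 (-1) : Cx R) * F z) _ _ cIm cNRe.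
rewrite /h /= cl1 cl2; apply.
- by move=> z /dF; apply: derivable_mulC; exact: derivable_cstC.
- by move=> w; case: (F _) => x y /=; ring.
- by move=> w; case: (F _) => x y /=; ring.
Qed.

End circle_average.

Section cavg_theory.
Context {R : realType}.
Implicit Types (s u v : R) (F G : Cx R -> Cx R) (c : Cx R).

Let pi2_gt0 : 0 < 2 * pi :> R. Proof. by rewrite mulr_gt0 // pi_gt0. Qed.

Definition circ_cont F s := continuous (fun v => F (polar s v)).

Lemma eq_cavg F G s : (forall v, F (polar s v) = G (polar s v)) -> cavg F s = cavg G s.
Proof.
by move=> FG; rewrite /cavg; congr (Complex (_ / _) (_ / _)); apply: eq_sint => v _; rewrite FG.
Qed.

Lemma cavgB F G s : circ_cont F s -> circ_cont G s ->
  cavg (fun z => F z - G z) s = cavg F s - cavg G s.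
Proof.
move=> cF cG; rewrite /cavg.
have -> (a b c d : R) : (Complex a b : Cx R) - Complex c d = Complex (a - c) (b - d) by [].
rewrite -!mulrBl -!sintB; try (by move=> v; exact/cvg_Re/cF); try (by move=> v; exact/cvg_Re/cG);
  try (by move=> v; exact/cvg_Im/cF); try (by move=> v; exact/cvg_Im/cG).
by congr (Complex (_ / _) (_ / _)); apply: eq_sint => v _; case: (F _); case: (G _).
Qed.

Lemma cavgZ c F s : circ_cont F s -> cavg (fun z => c * F z) s = c * cavg F s.
Proof.
move=> cF; rewrite /cavg; case: c => a b.
have mulCx (a' b' c d : R) :
  (Complex a' b' : Cx R) * Complex c d = Complex (a' * c - b' * d) (a' * d + b' * c) by [].
have cRe : continuous (fun v => complex.Re (F (polar s v))) by move=> v; exact/cvg_Re/cF.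
have cIm : continuous (fun v => complex.Im (F (polar s v))) by move=> v; exact/cvg_Im/cF.
have cM k (f : R -> R) : continuous f -> continuous (fun v => k * f v).
  by move=> cf v; apply: cvgM; [exact: cvg_cst|exact: cf].
rewrite mulCx !mulrA -!sintZ // -mulrBl -mulrDl -sintB -?sintD; try exact: cM.
by congr (Complex (_ / _) (_ / _)); apply: eq_sint => v _; case: (F _).
Qed.

Lemma cavg_cst c s : cavg (fun=> c) s = c.
Proof.
by rewrite /cavg !sint_cst ?ltW // subr0 !mulfK ?gt_eqF //; case: c.
Qed.

(** Bounding the two components separately would lose a constant. Instead [cabs A ^+ 2] is written
    as the average of the real part of the conjugate of [A] times [F], which is at most
    [cabs A * K]. *)
Lemma cavg_bound F s K : circ_cont F s -> (forall v, cabs (F (polar s v)) <= K) ->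
  cabs (cavg F s) <= K.
Proof.
move=> cF FK; have K0 : 0 <= K by apply: le_trans (FK 0); exact: cabs_ge0.
set A := cavg F s; set x := complex.Re A; set y := complex.Im A.
have cRe : continuous (fun v => complex.Re (F (polar s v))) by move=> v; exact/cvg_Re/cF.
have cIm : continuous (fun v => complex.Im (F (polar s v))) by move=> v; exact/cvg_Im/cF.
have cM k (f : R -> R) : continuous f -> continuous (fun v => k * f v).
  by move=> cf v; apply: cvgM; [exact: cvg_cst|exact: cf].
have : cabs A ^+ 2 <= cabs A * K.
  rewrite sqr_cabs !expr2 -/x -/y {2}/x {2}/y /A /cavg /= !mulrA -!sintZ // -mulrDl.
  rewrite -sintD; try exact: cM.
  have E : cabs A * K * (2 * pi) = sint (fun=> cabs A * K) 0 (2 * pi).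
    by rewrite sint_cst ?ltW // subr0.
  rewrite ler_pdivrMr // E.
  apply: sint_le => [v||v _]; first by apply: cvgD; exact: cM.
  - by move=> v; exact: cvg_cst.
  - apply: le_trans (ler_wpM2l (cabs_ge0 A) (FK v)).
    have -> : x * complex.Re (F (polar s v)) + y * complex.Im (F (polar s v)) =
        complex.Re ((Complex x (- y) : Cx R) * F (polar s v)).
      by case: (F _) => a b /=; ring.
    apply: le_trans (ler_norm _) _; apply: le_trans (ler_Re_cabs _) _.
    by rewrite cabsM ler_wpM2r ?cabs_ge0 // /cabs /cabs2 /= sqrrN.
have [->|A0] := eqVneq (cabs A) 0; first by [].
by rewrite expr2 ler_pM2l // lt0r A0 cabs_ge0.
Qed.

Lemma within_subset (D E : set (Cx R)) F : E `<=` D ->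
  {within D, continuous F} -> {within E, continuous F}.
Proof. by move=> ED; exact: continuous_subspaceW. Qed.

(** Tolerates one circle, of radius [m], on which [F] may fail to be differentiable: the averages
    are compared on each side of it, and [cavg_const] reaches the circle by continuity. *)
Lemma cavg_const_off s1 s2 m F : 0 < s1 ->
  {within annulus s1 s2, continuous F} ->
  (forall z, s1 < cabs z < s2 -> cabs z != m -> derivable F z 1) ->
  forall s u, s1 <= s -> s <= u -> u <= s2 -> cavg F s = cavg F u.
Proof.
move=> s1_gt0 cF dF.
have sub s u : s1 <= s -> u <= s2 -> {within annulus s u, continuous F}.
  move=> s1s us2; apply: within_subset cF => z /andP[sz zu].
  by rewrite /annulus /= (le_trans s1s) // (le_trans zu).
have go s u : s1 <= s -> s <= u -> u <= s2 -> m <= s \/ u <= m -> cavg F s = cavg F u.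
  move=> s1s su us2 ms; apply: cavg_const => //; [exact: lt_le_trans s1s|exact: sub|].
  move=> z /andP[sz zu]; apply: dF; first by rewrite (le_lt_trans s1s) // (lt_le_trans zu).
  by case: ms => [ms|um]; [rewrite gt_eqF // (le_lt_trans ms)|rewrite lt_eqF // (lt_le_trans zu)].
move=> s u s1s su us2.
have [ms|sm] := leP m s; first by apply: go => //; left.
have [um|mu] := leP u m; first by apply: go => //; right.
transitivity (cavg F m); apply: go; rewrite ?lexx ?(ltW sm) ?(ltW mu) //.
- exact: le_trans (ltW mu) us2.
- by right.
- exact: le_trans s1s (ltW sm).
- by left.
Qed.

End cavg_theory.

Section within_continuity.
Context {R : realType}.
Implicit Types (F G : Cx R -> Cx R) (z : Cx R) (D : set (Cx R)).

Lemma near_cabs z (e : R) : 0 < e -> \forall y \near z, cabs (y - z) < e.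
Proof. exact: ((@cvg_cabsP R _ (nbhs z) (nbhs_filter z) id z).1 (@cvg_id _ _)). Qed.

Lemma derivable_cvgC F z : derivable F z 1 -> F y @[y --> z] --> F z.
Proof.
move=> /derivable_cabs[D HD].
apply/(@cvg_cabsP R _ (nbhs z) (nbhs_filter z)) => e e0.
have [d d0 Hd] := HD _ ltr01.
have D1 : 0 < cabs D + 1 by rewrite ltr_wpDl ?cabs_ge0.
near=> y.
have yd : cabs (y - z) < d by near: y; exact: near_cabs.
have ye : cabs (y - z) < e / (cabs D + 1) by near: y; apply: near_cabs; rewrite divr_gt0.
have := Hd _ yd; rewrite (addrC z) subrK mul1r => h.
rewrite -[F y - F z](subrK (D * (y - z))); apply: le_lt_trans (cabsD _ _) _.
rewrite cabsM; rewrite ltr_pdivlMr // in ye; lra.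
Unshelve. all: by end_near. Qed.

Lemma within_derivable D F : (forall z, D z -> derivable F z 1) ->
  {within D, continuous F}.
Proof.
move=> dF; apply/subspace_continuousP => z Dz.
by apply: cvg_within_filter; apply: derivable_cvgC; exact: dF.
Qed.

Lemma cvg_mulC {T : Type} {X : set_system T} {FX : Filter X} (f g : T -> Cx R) (a b : Cx R) :
  f @ X --> a -> g @ X --> b -> f x * g x @[x --> X] --> a * b.
Proof. exact (@cvgM (complex R) T X FX f g a b). Qed.

Lemma cvg_subC {T : Type} {X : set_system T} {FX : Filter X} (f g : T -> Cx R) (a b : Cx R) :
  f @ X --> a -> g @ X --> b -> f x - g x @[x --> X] --> a - b.
Proof. exact (@cvgB (complex R) (Cx R) T X FX f g a b). Qed.

Lemma within_mulC D F G : {within D, continuous F} -> {within D, continuous G} ->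
  {within D, continuous (fun z => F z * G z)}.
Proof.
move=> /subspace_continuousP cF /subspace_continuousP cG; apply/subspace_continuousP => z Dz.
by apply: cvg_mulC; [exact: cF|exact: cG].
Qed.

(** The value [c] at [z0] is meant to be the derivative of [F] there, which makes the quotient
    continuous. It is a parameter because [derivable_cabs] provides the derivative only
    existentially. *)
Definition dquot F z0 (c z : Cx R) : Cx R :=
  if z == z0 then c else (F z - F z0) / (z - z0).

Lemma dquotE F z0 c z : dquot F z0 c z * (z - z0) = F z - F z0.
Proof.
rewrite /dquot; case: eqVneq => [->|zz0]; first by rewrite !subrr mulr0.
by rewrite divfK // subr_eq0.
Qed.

Lemma near_neqC z z0 : z != z0 -> \forall y \near z, y != z0.
Proof.
move=> zz0; have H : 0 < cabs (z - z0) by rewrite lt0r cabs_eq0 subr_eq0 zz0 cabs_ge0.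
near=> y; apply/eqP => yz.
have : cabs (y - z) < cabs (z - z0) by near: y; exact: near_cabs.
by rewrite yz cabsB ltxx.
Unshelve. all: by end_near. Qed.

Lemma dquot_derivable F z0 c z : z != z0 -> derivable F z 1 ->
  derivable (dquot F z0 c) z 1.
Proof.
move=> zz0 dF.
apply: (@near_eq_derivable _ _ _ (fun z => (F z - F z0) * (z - z0)^-1)).
  by apply: filterS (near_neqC zz0) => y yz0; rewrite /dquot (negbTE yz0).
apply: derivable_mulC; first exact (derivable_subC dF (@derivable_cstC R (F z0) z)).
apply: derivable_invC; first by rewrite subr_eq0.
exact (derivable_subC (@derivable_idC R z) (@derivable_cstC R z0 z)).
Qed.

Lemma dquot_continuous D F z0 : derivable F z0 1 -> {within D, continuous F} ->
  exists c, {within D, continuous (dquot F z0 c)}.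
Proof.
move=> /derivable_cabs[c Hc] /subspace_continuousP cF; exists c.
apply/subspace_continuousP => z Dz; have [->|zz0] := eqVneq z z0.
  apply: cvg_within_filter; apply/(@cvg_cabsP R _ (nbhs z0) (nbhs_filter z0)) => e e0.
  have e20 : 0 < e / 2 by rewrite divr_gt0.
  have [d d0 Hd] := Hc _ e20.
  near=> y.
  have yd : cabs (y - z0) < d by near: y; exact: near_cabs.
  change (cabs (dquot F z0 c y - dquot F z0 c z0) < e).
  rewrite /dquot eqxx; case: eqVneq => [_|yz0]; first by rewrite subrr cabs0.
  have yz0' : y - z0 != 0 by rewrite subr_eq0.
  have -> : (F y - F z0) / (y - z0) - c = (F y - F z0 - c * (y - z0)) / (y - z0).
    by rewrite [in RHS]mulrBl mulfK.
  rewrite cabsM cabsV ltr_pdivrMr ?lt0r ?cabs_eq0 ?yz0' ?cabs_ge0 //.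
  have := Hd _ yd; rewrite (addrC z0) subrK => h; apply: le_lt_trans h _.
  have y0 : 0 < cabs (y - z0) by rewrite lt0r cabs_eq0 yz0' cabs_ge0.
  by rewrite ltr_pM2r // ltr_pdivrMr // ltr_pMr // ltr1n.
have E : \forall y \near within D (nbhs z), (F y - F z0) * (y - z0)^-1 = dquot F z0 c y.
  apply: cvg_within; apply: filterS (near_neqC zz0) => y yz0.
  by rewrite /dquot (negbTE yz0).
apply: cvg_trans (near_eq_cvg E) _.
have Ez : from_subspace D (dquot F z0 c) z = (F z - F z0) * (z - z0)^-1.
  by rewrite /from_subspace /dquot (negbTE zz0).
rewrite Ez; apply: cvg_mulC.
  by apply: cvg_subC; [exact: cF|exact: cvg_cst].
apply: cvg_within_filter.
apply: (@derivable_cvgC (fun y => (y - z0)^-1)).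
apply: derivable_invC; first by rewrite subr_eq0.
exact (derivable_subC (@derivable_idC R z) (@derivable_cstC R z0 z)).
Unshelve. all: by end_near. Qed.

End within_continuity.

(** * Laurent series on an annulus *)

Section laurent.
Context {R : realType} (rho K : R) (F : Cx R -> Cx R).
Implicit Types (z : Cx R) (s m C : R) (G : Cx R -> Cx R) (n : nat).

Hypothesis rho1 : 1 < rho.
Hypothesis F_cont : {within annulus rho^-1 rho, continuous F}.
Hypothesis F_der : forall z, rho^-1 < cabs z < rho -> derivable F z 1.
Hypothesis F_bound : forall z, cabs z = rho \/ cabs z = rho^-1 -> cabs (F z) <= K.

Let rho0 : 0 < rho. Proof. exact: lt_trans rho1. Qed.
Let rhoV0 : 0 < rho^-1. Proof. by rewrite invr_gt0. Qed.
Let rhoV1 : rho^-1 < 1. Proof. by rewrite invf_lt1. Qed.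

Lemma derivable_pow n z : derivable (fun z : Cx R => z ^+ n) z 1.
Proof. exact (@derivable_expC R (fun z => z) n z (@derivable_idC R z)). Qed.

Lemma derivable_powV n z : z != 0 -> derivable (fun z : Cx R => z ^- n) z 1.
Proof. by move=> z0; apply: derivable_invC; [exact: expf_neq0|exact: derivable_pow]. Qed.

Lemma cabs_gt0_neq0 z : 0 < cabs z -> z != 0.
Proof. by rewrite lt0r cabs_eq0 => /andP[]. Qed.

Lemma within_pow n (D : set (Cx R)) : {within D, continuous (fun z : Cx R => z ^+ n)}.
Proof. by apply: within_derivable => z _; exact: derivable_pow. Qed.

Lemma within_powV n s1 s2 : 0 < s1 ->
  {within annulus s1 s2, continuous (fun z : Cx R => z ^- n)}.
Proof.
move=> s10; apply: within_derivable => z /andP[s1z _]; apply: derivable_powV.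
by apply: cabs_gt0_neq0; exact: lt_le_trans s1z.
Qed.

Lemma cavg_scale (G : Cx R -> Cx R) s : cavg G s = cavg (fun z => G (polar s 0 * z)) 1.
Proof.
by rewrite /cavg; congr (Complex (_ / _) (_ / _)); apply: eq_sint => v _;
  rewrite polarM mulr1 add0r.
Qed.

(* The averages over the circles of radius 1 and 2 agree, but also differ by the
   factor [c]; this avoids integrating [z ^+ n] explicitly. *)
Lemma cavg_homogeneous (G : Cx R -> Cx R) (c : Cx R) :
  {within annulus 1 2, continuous G} -> (forall z, 1 < cabs z < 2 -> derivable G z 1) ->
  (forall z, G (polar 2 0 * z) = c * G z) -> c != 1 -> cavg G 1 = 0.
Proof.
move=> cG dG hG c1; have := cavg_const ltr01 _ cG dG.
rewrite ler1n => /(_ isT); rewrite (cavg_scale G 2) 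
  (@eq_cavg R _ (fun z => c * G z) 1 (fun v => hG _)).
rewrite cavgZ; last by apply: circle_continuous cG; rewrite ?lexx ?ler1n.
move=> /eqP; rewrite -subr_eq0 -[X in X - _]mul1r -mulrBl mulf_eq0 subr_eq0 eq_sym.
by rewrite (negbTE c1) => /eqP.
Qed.

Lemma cavg_pow n : cavg (fun z => z ^+ n.+1) 1 = 0 :> Cx R.
Proof.
apply: (@cavg_homogeneous _ (polar 2 0 ^+ n.+1)).
- exact: within_pow.
- by move=> z _; exact: derivable_pow.
- by move=> z; rewrite exprMn.
- apply/eqP => /(congr1 cabs)/eqP; rewrite cabsX cabs_polar cabs1 ger0_norm // gt_eqF //.
  by rewrite exprn_egt1 // ltr1n.
Qed.

Lemma cavg_powV n : cavg (fun z => z ^- n.+1) 1 = 0 :> Cx R.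
Proof.
apply: (@cavg_homogeneous _ (polar 2 0 ^- n.+1)).
- exact: within_powV.
- move=> z /andP[z1 _]; apply: derivable_powV; apply: cabs_gt0_neq0; exact: lt_trans z1.
- by move=> z; rewrite exprMn invfM.
- apply/eqP => /(congr1 cabs)/eqP; rewrite cabsV cabsX cabs_polar cabs1 ger0_norm // lt_eqF //.
  by rewrite invf_lt1 ?exprn_gt0 // exprn_egt1 // ltr1n.
Qed.

Let circ G s : {within annulus rho^-1 rho, continuous G} -> rho^-1 <= s <= rho ->
  circ_cont G s.
Proof. by move=> cG hs; exact: (circle_continuous rhoV0 hs cG). Qed.

Let outer_bound G C n : {within annulus rho^-1 rho, continuous G} ->
  (forall z, cabs z = rho -> cabs (G z) <= C) ->
  cabs (cavg (fun z => G z * z ^- n) rho) <= C / rho ^+ n.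
Proof.
move=> cG GC; apply: cavg_bound => [|v].
  apply: circ; last by rewrite lexx andbT ltW // (lt_trans rhoV1).
  exact (within_mulC cG (@within_powV n rho^-1 rho rhoV0)).
have cz : cabs (polar rho v) = rho by rewrite cabs_polar ger0_norm // ltW.
by rewrite cabsM cabsV cabsX cz ler_wpM2r ?GC // invr_ge0 exprn_ge0 // ltW.
Qed.

Let inner_bound G C n : {within annulus rho^-1 rho, continuous G} ->
  (forall z, cabs z = rho^-1 -> cabs (G z) <= C) ->
  cabs (cavg (fun z => G z * z ^+ n) rho^-1) <= C / rho ^+ n.
Proof.
move=> cG GC; apply: cavg_bound => [|v].
  apply: circ; last by rewrite lexx ltW // (lt_trans rhoV1).
  exact (within_mulC cG (@within_pow n _)).
have cz : cabs (polar rho^-1 v) = rho^-1 by rewrite cabs_polar ger0_norm // ltW.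
by rewrite cabsM cabsX cz exprVn ler_wpM2r ?GC // invr_ge0 exprn_ge0 // ltW.
Qed.

Let unit_outer m G n : {within annulus rho^-1 rho, continuous G} ->
  (forall z, rho^-1 < cabs z < rho -> cabs z != m -> derivable G z 1) ->
  cavg (fun z => G z * z ^- n) 1 = cavg (fun z => G z * z ^- n) rho.
Proof.
move=> cG dG; apply: (@cavg_const_off R rho^-1 rho m _ rhoV0 _ _ _ _ (ltW rhoV1) (ltW rho1) (lexx _)).
- exact (within_mulC cG (@within_powV n rho^-1 rho rhoV0)).
- move=> z hz zm; apply: derivable_mulC; first exact: dG.
  by apply: derivable_powV; apply: cabs_gt0_neq0; case/andP: hz => h _; exact: lt_trans h.
Qed.

Let unit_inner m G n : {within annulus rho^-1 rho, continuous G} ->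
  (forall z, rho^-1 < cabs z < rho -> cabs z != m -> derivable G z 1) ->
  cavg (fun z => G z * z ^+ n) 1 = cavg (fun z => G z * z ^+ n) rho^-1.
Proof.
move=> cG dG; symmetry; apply: (@cavg_const_off R rho^-1 rho m _ rhoV0 _ _ _ _ (lexx _) (ltW rhoV1) (ltW rho1)).
- exact (within_mulC cG (@within_pow n _)).
- move=> z hz zm; apply: derivable_mulC; first exact: dG.
  exact: derivable_pow.
Qed.

Definition laurent_pos n : Cx R := cavg (fun z => F z * z ^- n) 1.
Definition laurent_neg n : Cx R := cavg (fun z => F z * z ^+ n) 1.
Definition laurent_sum N z : Cx R := laurent_pos 0 +
  \sum_(k < N) (laurent_pos k.+1 * z ^+ k.+1 + laurent_neg k.+1 * z ^- k.+1).

(** The average is moved to the outer circle, where [z ^- n] has modulus [rho ^- n]; the negative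
    coefficients are moved to the inner circle for the same gain. The exceptional radius 1 is a
    dummy, since [F] is differentiable on the whole open annulus. *)
Lemma laurent_pos_bound n : cabs (laurent_pos n) <= K / rho ^+ n.
Proof.
rewrite /laurent_pos (@unit_outer 1 F n F_cont); last by move=> z /F_der.
by apply: (outer_bound n F_cont) => z zr; apply: F_bound; left.
Qed.

Lemma laurent_neg_bound n : cabs (laurent_neg n) <= K / rho ^+ n.
Proof.
rewrite /laurent_neg (@unit_inner 1 F n F_cont); last by move=> z /F_der.
by apply: (inner_bound n F_cont) => z zr; apply: F_bound; right.
Qed.

Section point.
Variables (z0 : Cx R) (c : Cx R).
Hypothesis z0_in : rho^-1 < cabs z0 < rho.
Hypothesis G_cont : {within annulus rho^-1 rho, continuous (dquot F z0 c)}.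
Let G := dquot F z0 c.
Let Gp n := cavg (fun z => G z * z ^- n) 1.
Let Gm n := cavg (fun z => G z * z ^+ n) 1.

Let unit_in : rho^-1 <= 1 <= rho. Proof. by rewrite !ltW. Qed.

Let pow_circ n : circ_cont (fun z : Cx R => z ^+ n) 1.
Proof. exact (circ (@within_pow n _) unit_in). Qed.
Let powV_circ n : circ_cont (fun z : Cx R => z ^- n) 1.
Proof. exact (circ (@within_powV n rho^-1 rho rhoV0) unit_in). Qed.
Let Gp_circ n : circ_cont (fun z => G z * z ^- n) 1.
Proof. exact (circ (within_mulC G_cont (@within_powV n rho^-1 rho rhoV0)) unit_in). Qed.
Let Gm_circ n : circ_cont (fun z => G z * z ^+ n) 1.
Proof. exact (circ (within_mulC G_cont (@within_pow n _)) unit_in). Qed.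
Let polar1_neq0 v : polar 1 v != 0 :> Cx R.
Proof. by apply: cabs_gt0_neq0; rewrite cabs_polar normr1. Qed.

Let circZ (k : Cx R) (H : Cx R -> Cx R) s : circ_cont H s -> circ_cont (fun z => k * H z) s.
Proof. by move=> cH v; apply: cvg_mulC; [exact: cvg_cst|exact: cH]. Qed.

Let cavg3 (f1 f2 f3 : Cx R -> Cx R) (a b : Cx R) s :
  circ_cont f1 s -> circ_cont f2 s -> circ_cont f3 s ->
  cavg (fun z => f1 z - a * f2 z - b * f3 z) s = cavg f1 s - a * cavg f2 s - b * cavg f3 s.
Proof.
move=> c1 c2 c3; have c12 : circ_cont (fun z => f1 z - a * f2 z) s.
  by move=> v; apply: cvg_subC; [exact: c1|exact: (@circZ a f2 s c2 v)].
rewrite (@cavgB R _ _ s c12 (@circZ b f3 s c3)) (@cavgB R _ _ s c1 (@circZ a f2 s c2)).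
by rewrite (@cavgZ R a f2 s c2) (@cavgZ R b f3 s c3).
Qed.

Let FE z : F z = F z0 + G z * (z - z0).
Proof. by rewrite dquotE addrC subrK. Qed.

(** Only this coefficient retains the constant [F z0]: in [pos_rec] and [neg_rec] it is multiplied
    by the average of a nonzero power of [z], which vanishes. *)
Let pos0 : laurent_pos 0 = F z0 + Gm 1 - z0 * Gp 0.
Proof.
transitivity (cavg (fun z => G z * z ^+ 1 - z0 * (G z / z ^+ 0) - (- F z0) * z ^- 0) 1).
  by apply: eq_cavg => v; rewrite (FE (polar 1 v)) !expr0 expr1; field.
rewrite (@cavg3 _ _ _ _ _ _ (@Gm_circ 1) (@Gp_circ 0) (@powV_circ 0)).
rewrite (@eq_cavg R (fun z : Cx R => z ^- 0) (fun=> 1) 1); last by move=> v; rewrite expr0 invr1.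
by rewrite cavg_cst -/(Gm 1) -/(Gp 0); ring.
Qed.

Let pos_rec n : laurent_pos n.+1 = Gp n - z0 * Gp n.+1.
Proof.
transitivity (cavg (fun z => G z / z ^+ n - z0 * (G z / z ^+ n.+1) - (- F z0) * z ^- n.+1) 1).
  apply: eq_cavg => v; rewrite (FE (polar 1 v)) exprSr.
  by field; rewrite ?expf_neq0 ?polar1_neq0.
rewrite (@cavg3 _ _ _ _ _ _ (@Gp_circ n) (@Gp_circ n.+1) (@powV_circ n.+1)).
by rewrite cavg_powV mulr0 subr0.
Qed.

Let neg_rec n : laurent_neg n.+1 = Gm n.+2 - z0 * Gm n.+1.
Proof.
transitivity (cavg (fun z => G z * z ^+ n.+2 - z0 * (G z * z ^+ n.+1) - (- F z0) * z ^+ n.+1) 1).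
  by apply: eq_cavg => v; rewrite (FE (polar 1 v)) !exprSr; ring.
rewrite (@cavg3 _ _ _ _ _ _ (@Gm_circ n.+2) (@Gm_circ n.+1) (@pow_circ n.+1)).
by rewrite cavg_pow mulr0 subr0.
Qed.

Let z0_neq0 : z0 != 0.
Proof. by apply: cabs_gt0_neq0; case/andP: z0_in => h _; exact: lt_trans h. Qed.

Lemma laurent_sumE N : laurent_sum N z0 - F z0 = z0 ^- N * Gm N.+1 - z0 ^+ N.+1 * Gp N.
Proof.
elim: N => [|N IH].
  by rewrite /laurent_sum big_ord0 addr0 pos0 expr0 invr1 expr1; ring.
rewrite /laurent_sum big_ord_recr /= addrA -/(laurent_sum N z0) addrAC IH.
rewrite pos_rec neg_rec [z0 ^+ N.+2]exprSr [z0 ^+ N.+1]exprSr.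
by field; rewrite z0_neq0 expf_neq0 ?z0_neq0.
Qed.

(** The two coefficients of [G] left by the telescoping are estimated on the boundary circles, whose
    distances from [z0] are at least [cabs z0 - rho^-1] and [rho - cabs z0]. Moving the average
    there may cross the circle through [z0], which is the exceptional one. *)
Lemma laurent_sum_bound N : cabs (laurent_sum N z0 - F z0) <=
  (K + cabs (F z0)) / (cabs z0 - rho^-1) * (cabs z0 * rho) ^- N +
  (K + cabs (F z0)) / (rho - cabs z0) * cabs z0 * (cabs z0 / rho) ^+ N.
Proof.
rewrite laurent_sumE (le_trans (cabsD _ _)) // cabsN.
have [z0l z0r] := andP z0_in.
have z00 : 0 < cabs z0 by exact: lt_trans z0l.
have Goff z : rho^-1 < cabs z < rho -> cabs z != cabs z0 -> derivable G z 1.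
  move=> hz zz0; apply: dquot_derivable; last exact: F_der.
  by apply: contraNneq zz0 => ->.
have Gb z d : cabs z = rho \/ cabs z = rho^-1 -> 0 < d -> d <= cabs (z - z0) ->
    cabs (G z) <= (K + cabs (F z0)) / d.
  move=> hz d0 dz; have zz0 : z != z0.
    by rewrite -subr_eq0 -cabs_eq0 gt_eqF // (lt_le_trans d0).
  rewrite /G /dquot (negbTE zz0) cabsM cabsV ler_pM ?invr_ge0 ?cabs_ge0 //.
    by rewrite (le_trans (cabsD _ _)) // cabsN lerD2r F_bound.
  by rewrite lef_pV2 // posrE (lt_le_trans d0).
have sub_le z w : cabs z - cabs w <= cabs (z - w).
  by rewrite lerBlDr -{1}(subrK w z) cabsD.
have Gmb : cabs (Gm N.+1) <= (K + cabs (F z0)) / (cabs z0 - rho^-1) / rho ^+ N.+1.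
  rewrite /Gm (@unit_inner (cabs z0) G N.+1 G_cont Goff).
  apply: (inner_bound N.+1 G_cont) => z zr; apply: Gb; rewrite ?subr_gt0 //; first by right.
  by rewrite -zr cabsB.
have Gpb : cabs (Gp N) <= (K + cabs (F z0)) / (rho - cabs z0) / rho ^+ N.
  rewrite /Gp (@unit_outer (cabs z0) G N G_cont Goff).
  apply: (outer_bound N G_cont) => z zr; apply: Gb; rewrite ?subr_gt0 //; first by left.
  by rewrite -zr.
have K0 : 0 <= K + cabs (F z0).
  rewrite addr_ge0 ?cabs_ge0 //; apply: le_trans (cabs_ge0 (F (polar rho 0))) _.
  by apply: F_bound; left; rewrite cabs_polar ger0_norm // ltW.
rewrite !cabsM cabsV !cabsX lerD //.
  apply: le_trans (ler_wpM2l _ Gmb) _; first by rewrite invr_ge0 exprn_ge0 // cabs_ge0.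
  rewrite [leLHS](_ : _ = (K + cabs (F z0)) / (cabs z0 - rho^-1) * (cabs z0 * rho) ^- N / rho).
    rewrite ler_piMr // ?invf_le1 ?(ltW rho1) //.
    by rewrite mulr_ge0 ?invr_ge0 ?exprn_ge0 ?divr_ge0 ?subr_ge0 ?mulr_ge0 // ltW.
  rewrite exprSr exprMn; field.
  have z0rho : cabs z0 * rho - 1 != 0.
    by rewrite gt_eqF // subr_gt0 -ltr_pdivrMr // div1r.
  by rewrite z0rho !expf_neq0 ?gt_eqF.
apply: le_trans (ler_wpM2l _ Gpb) _; first by rewrite exprn_ge0 // cabs_ge0.
rewrite exprS expr_div_n [leLHS](_ : _ = (K + cabs (F z0)) / (rho - cabs z0) * cabs z0 * (cabs z0 ^+ N / rho ^+ N)) //.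
by field; rewrite expf_neq0 ?gt_eqF // subr_gt0.
Qed.

End point.

Lemma laurent_sum_cvg z : rho^-1 < cabs z < rho ->
  forall e, 0 < e -> \forall N \near \oo, cabs (laurent_sum N z - F z) <= e.
Proof.
move=> z_in e e0.
have [c cG] := dquot_continuous (F_der z_in) F_cont.
have [zl zr] := andP z_in.
have z0 : 0 < cabs z by exact: lt_trans zl.
have q1 : `|(cabs z * rho)^-1| < 1.
  rewrite ger0_norm ?invr_ge0 ?mulr_ge0 ?(ltW z0) ?(ltW rho0) //.
  by rewrite invf_lt1 ?mulr_gt0 // -ltr_pdivrMr // div1r.
have q2 : `|cabs z / rho| < 1.
  rewrite ger0_norm ?divr_ge0 ?(ltW z0) ?(ltW rho0) //.
  by rewrite ltr_pdivrMr // mul1r.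
set C1 := (K + cabs (F z)) / (cabs z - rho^-1).
set C2 := (K + cabs (F z)) / (rho - cabs z) * cabs z.
have : C1 * (cabs z * rho)^-1 ^+ N + C2 * (cabs z / rho) ^+ N @[N --> \oo] --> C1 * 0 + C2 * 0.
  by apply: cvgD; (apply: cvgM; [exact: cvg_cst|exact: cvg_expr]).
rewrite !mulr0 addr0 => /cvgrPdist_le/(_ _ e0) H; near=> N.
apply: le_trans (laurent_sum_bound z_in cG N) _.
have : `|0 - (C1 * (cabs z * rho)^-1 ^+ N + C2 * (cabs z / rho) ^+ N)| <= e by near: N.
by rewrite sub0r normrN exprVn; apply: le_trans; exact: ler_norm.
Unshelve. all: by end_near. Qed.

End laurent.

(** * Chebyshev truncation on a Bernstein ellipse *)

Section chebyshev.
Context {R : realType}.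

Fixpoint chebT_pair n : {poly R} * {poly R} :=
  if n is m.+1 then let p := chebT_pair m in (p.2, 2%:P * 'X * p.2 - p.1) else (1, 'X).
Definition chebT n := (chebT_pair n).1.

Lemma chebT0 : chebT 0 = 1. Proof. by []. Qed.
Lemma chebT1 : chebT 1 = 'X. Proof. by []. Qed.
Lemma chebTSS n : chebT n.+2 = 2%:P * 'X * chebT n.+1 - chebT n. Proof. by []. Qed.

Lemma size_chebT n : (size (chebT n) <= n.+1)%N.
Proof.
elim/nat_ind2: n => [||n IH IHS]; rewrite ?chebT0 ?chebT1 ?size_poly1 ?size_polyX //.
rewrite chebTSS (leq_trans (size_polyD _ _)) // geq_max size_polyN; apply/andP; split.
  rewrite -mulrA mul_polyC (leq_trans (size_scale_leq _ _)) //.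
  by rewrite (leq_trans (size_polyMleq _ _)) // size_polyX; exact: IHS.
by rewrite (leq_trans IH) // leqW.
Qed.

Lemma chebT_joukowski n (z : Cx R) (x : R) : z != 0 -> z + z^-1 = cR (2 * x) ->
  z ^+ n + z ^- n = cR (2 * (chebT n).[x]).
Proof.
move=> z0 zx; elim/nat_ind2: n => [||n IH IHS].
- by rewrite chebT0 hornerC expr0 invr1 mulr1; rewrite /cR; apply/eqP; rewrite eq_complex /= addr0 !eqxx.
- by rewrite chebT1 hornerX !expr1.
rewrite chebTSS !hornerE.
have -> : z ^+ n.+2 + z ^- n.+2 = (z + z^-1) * (z ^+ n.+1 + z ^- n.+1) - (z ^+ n + z ^- n).
  by rewrite !exprSr; field; rewrite expf_neq0 z0.
rewrite zx IH IHS /cR.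
have mulCx (a b : R) : (Complex a 0 : Cx R) * Complex b 0 - Complex 0 0 = Complex (a * b) 0.
  by apply/eqP; rewrite eq_complex /= !(mulr0, mul0r, subr0, addr0) !eqxx.
apply/eqP; rewrite eq_complex /= !(mulr0, mul0r, subr0, addr0, oppr0) !eqxx andbT.
by apply/eqP; ring.
Qed.

End chebyshev.

Section joukowski.
Context {R : realType}.
Implicit Types (z : Cx R).

Definition jouk z : Cx R := 2^-1 * (z + z^-1).

Lemma derivable_jouk z : z != 0 -> derivable jouk z 1.
Proof.
move=> z0; apply: (derivable_mulC (@derivable_cstC R _ z)).
apply: (derivable_addC (@derivable_idC R z)).
exact: (derivable_invC z0 (@derivable_idC R z)).
Qed.

(** The distances to the foci are those of [(z - 1)^2 / (2 z)] and [(z + 1)^2 / (2 z)] to 0, and the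
    parallelogram law adds them. Hence the circles of radii [s] and [s^-1] map to the same
    ellipse. *)
Lemma jouk_foci z : z != 0 ->
  cabs (jouk z - 1) + cabs (jouk z + 1) = cabs z + (cabs z)^-1.
Proof.
move=> z0; have c0 : cabs z != 0 by rewrite cabs_eq0.
have -> : jouk z - 1 = (z - 1) ^+ 2 / (2 * z) by rewrite /jouk; field.
have -> : jouk z + 1 = (z + 1) ^+ 2 / (2 * z) by rewrite /jouk; field.
have c2 : cabs (2 : Cx R) = 2.
  have -> : (2 : Cx R) = cR 2 by apply/eqP; rewrite eq_complex /= addr0 !eqxx.
  by rewrite cabs_cR ger0_norm.
rewrite !(cabsM (_ ^+ 2)) !cabsX !cabsV !(cabsM 2) !sqr_cabs c2 -mulrDl.
have -> : complex.Re (z - 1) ^+ 2 + complex.Im (z - 1) ^+ 2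
   + (complex.Re (z + 1) ^+ 2 + complex.Im (z + 1) ^+ 2) = 2 * (cabs z ^+ 2 + 1).
  by rewrite sqr_cabs; case: z {z0 c0} => a b /=; ring.
by field.
Qed.

Lemma within_comp (D E : set (Cx R)) (f g : Cx R -> Cx R) :
  {within D, continuous f} -> {within E, continuous g} -> (forall z, E z -> D (g z)) ->
  {within E, continuous (fun z => f (g z))}.
Proof.
move=> /subspace_continuousP cf /subspace_continuousP cg ED; apply/subspace_continuousP => z Ez.
apply: (@cvg_comp _ _ _ g f (within E (nbhs z)) (within D (nbhs (g z)))); last first.
  by apply: cf; exact: ED.
move=> W HW; apply: (@filterS _ (nbhs z) _ (fun y => E y -> D (g y) -> W (g y))
  (fun y => E y -> W (g y)) _ (cg z Ez _ HW)).
by move=> y h Ey; exact: (h Ey (ED _ Ey)).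
Qed.

End joukowski.

Section bernstein.
Context {R : realType} (rho K : R) (f : Cx R -> Cx R).
Hypothesis rho1 : 1 < rho.
Hypothesis f_cont : {within bernstein_closed rho, continuous f}.
Hypothesis f_der : forall z, bernstein_open rho z -> derivable f z 1.
Hypothesis f_bound : forall z, bernstein_boundary rho z -> cabs (f z) <= K.

Let rho0 : 0 < rho. Proof. exact: lt_trans rho1. Qed.
Let rhoV0 : 0 < rho^-1. Proof. by rewrite invr_gt0. Qed.
Let F z := f (jouk z).

Let annulus_neq0 z : rho^-1 <= cabs z -> z != 0.
Proof. by move=> h; apply: cabs_gt0_neq0; exact: lt_le_trans h. Qed.

Let F_cont : {within annulus rho^-1 rho, continuous F}.
Proof.
apply: (within_comp f_cont).
  by apply: within_derivable => z /andP[/annulus_neq0 z0 _]; exact: derivable_jouk.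
move=> z /andP[zl zr]; rewrite /bernstein_closed /= jouk_foci ?annulus_neq0 //.
have z0 : 0 < cabs z by exact: lt_le_trans zl.
rewrite -subr_ge0 (_ : _ - _ = (rho - cabs z) * (cabs z - rho^-1) / cabs z).
  by rewrite divr_ge0 ?mulr_ge0 ?subr_ge0 ?cabs_ge0.
by field; rewrite !gt_eqF.
Qed.

Let F_der z : rho^-1 < cabs z < rho -> derivable F z 1.
Proof.
move=> /andP[zl zr]; have z0 : 0 < cabs z by exact: lt_trans zl.
apply: derivable_compC; last by apply: derivable_jouk; apply: annulus_neq0; exact: ltW.
apply: f_der; rewrite /bernstein_open /= jouk_foci; last by apply: annulus_neq0; exact: ltW.
rewrite -subr_gt0 (_ : _ - _ = (rho - cabs z) * (cabs z - rho^-1) / cabs z).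
  by rewrite divr_gt0 ?mulr_gt0 ?subr_gt0.
by field; rewrite !gt_eqF.
Qed.

Let F_bound z : cabs z = rho \/ cabs z = rho^-1 -> cabs (F z) <= K.
Proof.
move=> hz; apply: f_bound; rewrite /bernstein_boundary /= jouk_foci.
  by case: hz => ->; rewrite // invrK addrC.
by apply: cabs_gt0_neq0; case: hz => ->.
Qed.

Let a := laurent_pos F.
Let b := laurent_neg F.
(** The Chebyshev coefficient of the real part of [f] on the real axis. The symmetry of [F] under
    inversion would make [a n] and [b n] equal; taking their sum avoids proving it. *)
Definition cheb_coef n : R :=
  if n is 0 then complex.Re (a 0) else complex.Re (a n) + complex.Re (b n).
Definition cheb_trunc n : {poly R} := \sum_(k < n.+1) cheb_coef k *: chebT k.

Lemma size_cheb_trunc n : (size (cheb_trunc n) <= n.+1)%N.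
Proof.
apply: (leq_trans (size_sum _ _ _)); apply/bigmax_leqP => k _.
by rewrite (leq_trans (size_scale_leq _ _)) // (leq_trans (size_chebT _)) // ltn_ord.
Qed.

Lemma cheb_coef_bound n : `|cheb_coef n.+1| <= 2 * K / rho ^+ n.+1.
Proof.
apply: le_trans (ler_normD _ _) _; rewrite -mulrA mulrDl mul1r lerD //.
  apply: le_trans (ler_Re_cabs _) _; exact: (laurent_pos_bound rho1 F_cont F_der F_bound).
apply: le_trans (ler_Re_cabs _) _; exact: (laurent_neg_bound rho1 F_cont F_der F_bound).
Qed.

Let half : (2^-1 : Cx R) = cR 2^-1.
Proof. by rewrite /cR -[RHS]/((2^-1)%:C)%C fmorphV rmorph_nat. Qed.

(** The points [z] and [z^-1] lie over the same [x]. Averaging the two Laurent sums pairs each power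
    with its inverse, and [z ^+ k + z ^- k] is twice a Chebyshev value. *)
Lemma jouk_sum_Re N (z : Cx R) (x : R) : z != 0 -> z + z^-1 = cR (2 * x) ->
  complex.Re (2^-1 * (laurent_sum F N z + laurent_sum F N z^-1)) = (cheb_trunc N).[x].
Proof.
move=> z0 zx; elim: N => [|N IH].
  have E w : laurent_sum F 0 w = a 0 by rewrite /laurent_sum big_ord0 addr0.
  have -> : cheb_trunc 0 = (complex.Re (a 0))%:P.
    by rewrite /cheb_trunc big_ord_recl big_ord0 addr0 /= alg_polyC.
  by rewrite !E half Re_cRM ReD hornerC; field.
have LS w : laurent_sum F N.+1 w =
    laurent_sum F N w + (a N.+1 * w ^+ N.+1 + b N.+1 * w ^- N.+1).
  by rewrite /laurent_sum big_ord_recr addrA.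
rewrite /cheb_trunc big_ord_recr hornerD -/(cheb_trunc N) -IH hornerZ !LS exprVn invrK.
set u := laurent_sum F N z; set v := laurent_sum F N z^-1.
have := chebT_joukowski N.+1 z0 zx.
set p := z ^+ _; set q := _^-1; set T := (chebT _).[x] => pq.
have -> : 2^-1 * (u + (a N.+1 * p + b N.+1 * q) + (v + (a N.+1 * q + b N.+1 * p))) =
    2^-1 * (u + v) + 2^-1 * ((p + q) * (a N.+1 + b N.+1)) by ring.
rewrite pq half ReD !Re_cRM ReD -[cheb_coef _]/(complex.Re (a N.+1) + complex.Re (b N.+1)).
by congr (_ + _); field.
Qed.

Lemma cheb_trunc_step n m (x s : R) : 1 <= s -> s < rho ->
  (forall k, `|(chebT k).[x]| <= s ^+ k) ->
  `|(cheb_trunc (n + m)).[x] - (cheb_trunc n).[x]| <=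
    2 * K * (s / rho) ^+ n.+1 * (1 - (s / rho) ^+ m) / (1 - s / rho).
Proof.
move=> s1 sr Ts; set r := s / rho.
have r1 : 0 < 1 - r by rewrite subr_gt0 /r ltr_pdivrMr // mul1r.
elim: m => [|m IH]; first by rewrite addn0 !subrr normr0 mulr0 mul0r.
rewrite addnS /cheb_trunc big_ord_recr /= hornerD -/(cheb_trunc (n + m)) addrAC.
apply: le_trans (ler_normD _ _) _; apply: le_trans (lerD IH _) _.
  rewrite hornerZ normrM; apply: ler_pM (cheb_coef_bound _) (Ts _) => //.
rewrite le_eqVlt; apply/orP; left; apply/eqP.
have -> : 2 * K / rho ^+ (n + m).+1 * s ^+ (n + m).+1 = 2 * K * r ^+ n.+1 * r ^+ m.
  by rewrite -addSn /r !expr_div_n !exprD; field; rewrite !expf_neq0 ?gt_eqF.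
by rewrite (exprS r m); field; rewrite gt_eqF.
Qed.

(** Serves twice: with [cabs z = 1] it bounds the truncation error at the nodes, and with [z] real
    and larger than 1 the error at the extrapolation point. *)
Lemma cheb_trunc_near n (z : Cx R) (x : R) : 1 <= cabs z -> cabs z < rho ->
  z + z^-1 = cR (2 * x) ->
  `|complex.Re (f (cR x)) - (cheb_trunc n).[x]| <=
    2 * K * (cabs z / rho) ^+ n.+1 / (1 - cabs z / rho).
Proof.
move=> z1 zr zx; have z0 : z != 0 by apply: cabs_gt0_neq0; exact: lt_le_trans z1.
have zV1 : rho^-1 < cabs z by apply: lt_le_trans z1; rewrite invf_lt1.
have r1 : 0 < 1 - cabs z / rho by rewrite subr_gt0 ltr_pdivrMr // mul1r.
have K0 : 0 <= K.
  apply: le_trans (cabs_ge0 (F (polar rho 0))) _; apply: F_bound.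
  by left; rewrite cabs_polar ger0_norm // ltW.
(* A Chebyshev value is half of [z ^+ k + z ^- k], and the second power has modulus at most 1. *)
have Ts k : `|(chebT k).[x]| <= cabs z ^+ k.
  have zk := chebT_joukowski k z0 zx.
  rewrite -(@ler_pM2l _ 2) // -{1}[2]ger0_norm // -normrM -cabs_cR -zk.
  apply: le_trans (cabsD _ _) _; rewrite cabsV !cabsX mulrDl mul1r lerD2l.
  rewrite (@le_trans _ _ 1) ?exprn_ege1 // invf_le1 ?exprn_ege1 //.
  by rewrite exprn_gt0 // (lt_le_trans _ z1).
have Fz : F z = f (cR x).
  by rewrite /F /jouk zx half cRM mulKf.
have FzV : F z^-1 = f (cR x).
  by rewrite /F /jouk invrK addrC -/(jouk z).
apply/ler_addgt0Pr => e e0.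
have zV : rho^-1 < cabs z^-1 by rewrite cabsV ltf_pV2 // posrE (lt_le_trans _ z1).
have zVr : cabs z^-1 < rho.
  by rewrite cabsV (le_lt_trans _ rho1) // invf_le1 // (lt_le_trans _ z1).
have e20 : 0 < e by [].
have [N nN [H1 H2]] : exists2 N, (n <= N)%N &
   cabs (laurent_sum F N z - F z) <= e /\ cabs (laurent_sum F N z^-1 - F z^-1) <= e.
  have /= h1 := laurent_sum_cvg rho1 F_cont F_der F_bound (introT andP (conj zV1 zr)) e0.
  have /= h2 := laurent_sum_cvg rho1 F_cont F_der F_bound (introT andP (conj zV zVr)) e0.
  have [N [h1N [h2N nN]]] : exists N, cabs (laurent_sum F N z - F z) <= e /\
      (cabs (laurent_sum F N z^-1 - F z^-1) <= e /\ (n <= N)%N).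
    apply: (@filter_ex _ \oo); apply: filterI => //; apply: filterI => //.
    exact: nbhs_infty_ge.
  by exists N.
rewrite Fz in H1; rewrite FzV in H2.
have HN : `|complex.Re (f (cR x)) - (cheb_trunc N).[x]| <= e.
  rewrite -(jouk_sum_Re N z0 zx) distrC.
  set u := laurent_sum F N z in H1 *; set v := laurent_sum F N z^-1 in H2 *.
  have -> : complex.Re (2^-1 * (u + v)) - complex.Re (f (cR x)) =
      (complex.Re (u - f (cR x)) + complex.Re (v - f (cR x))) / 2.
    by rewrite half Re_cRM; case: (u) => ? ?; case: (v) => ? ?; case: (f _) => ? ? /=; field.
  rewrite normrM normfV [`|2|]ger0_norm // ler_pdivrMr //.
  apply: le_trans (ler_normD _ _) _; rewrite mulr_natr mulr2n.
  by apply: lerD; [exact: le_trans (ler_Re_cabs _) H1|exact: le_trans (ler_Re_cabs _) H2].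
have := cheb_trunc_step n (N - n) z1 zr Ts; rewrite subnKC // => Hs.
rewrite -(subrKA (cheb_trunc N).[x]) (le_trans (ler_normD _ _)) //.
rewrite [leRHS]addrC lerD //; apply: le_trans Hs _.
rewrite ler_pM2r ?invr_gt0 // ler_piMr ?mulr_ge0 ?exprn_ge0 ?divr_ge0 ?cabs_ge0 ?(ltW rho0) //.
by rewrite gerBl exprn_ge0 // divr_ge0 ?cabs_ge0 ?(ltW rho0).
Qed.

End bernstein.

(** * Least squares *)

Section holomorphic_closure.
Context {R : realType} (D U : set (Cx R)).

Definition holo (F : Cx R -> Cx R) :=
  {within D, continuous F} /\ forall z, U z -> derivable F z 1.

Lemma holo_cst (c : Cx R) : holo (fun=> c).
Proof.
split=> [|z _]; last exact: derivable_cstC.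
by apply: within_derivable => z _; exact: derivable_cstC.
Qed.

Lemma holoM F G : holo F -> holo G -> holo (fun z => F z * G z).
Proof.
move=> [cF dF] [cG dG]; split=> [|z Uz]; first exact: within_mulC cF cG.
exact: derivable_mulC (dF z Uz) (dG z Uz).
Qed.

Lemma holoD F G : holo F -> holo G -> holo (fun z => F z + G z).
Proof.
move=> [cF dF] [cG dG]; split=> [|z Uz]; last exact: derivable_addC (dF z Uz) (dG z Uz).
move: cF cG => /subspace_continuousP cF /subspace_continuousP cG; apply/subspace_continuousP => z Dz.
exact (@cvgD (complex R) (Cx R) _ _ _ _ _ _ _ (cF z Dz) (cG z Dz)).
Qed.

Lemma holo_sum (J : Type) (js : seq J) (P : pred J) (F : J -> Cx R -> Cx R) :
  (forall j, holo (F j)) -> holo (fun z => \sum_(j <- js | P j) F j z).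
Proof.
move=> hF; elim: js => [|j js IH].
  by under eq_fun do rewrite big_nil; exact: holo_cst.
under eq_fun do rewrite big_cons.
by case Pj: (P j); [exact: (holoD (hF j) IH)|exact: IH].
Qed.

Lemma holo_prod (J : Type) (js : seq J) (P : pred J) (F : J -> Cx R -> Cx R) :
  (forall j, holo (F j)) -> holo (fun z => \prod_(j <- js | P j) F j z).
Proof.
move=> hF; elim: js => [|j js IH].
  by under eq_fun do rewrite big_nil; exact: holo_cst.
under eq_fun do rewrite big_cons.
by case Pj: (P j); [exact: (holoM (hF j) IH)|exact: IH].
Qed.

Lemma holoV F : U `<=` D -> (forall z, D z -> F z != 0) -> holo F -> holo (fun z => (F z)^-1).
Proof.
move=> UD F0 [cF dF]; split=> [|z Uz].
  move: cF => /subspace_continuousP cF; apply/subspace_continuousP => z Dz.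
  exact (@cvgV (complex R) _ _ _ F (F z) (F0 z Dz) (cF z Dz)).
exact: derivable_invC (F0 z (UD z Uz)) (dF z Uz).
Qed.

Lemma holo_det m (B : Cx R -> 'M[Cx R]_m) :
  (forall i j, holo (fun z => B z i j)) -> holo (fun z => \det (B z)).
Proof.
move=> hB; apply: holo_sum => s; apply: holoM; first exact: holo_cst.
by apply: holo_prod => i; exact: hB.
Qed.

Lemma holo_adj m (B : Cx R -> 'M[Cx R]_m) :
  (forall i j, holo (fun z => B z i j)) -> forall i j, holo (fun z => (\adj (B z)) i j).
Proof.
move=> hB i j; under eq_fun do rewrite mxE /cofactor.
apply: holoM; first exact: holo_cst.
by apply: holo_det => k l; under eq_fun do rewrite !mxE; exact: hB.
Qed.

Lemma holo_entry m k (B : Cx R -> 'M[Cx R]_(m, k)) i j :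
  {within D, continuous B} -> analytic_on U B -> holo (fun z => B z i j).
Proof.
move=> /subspace_continuousP cB dB; split=> [|z Uz].
  apply/subspace_continuousP => z Dz.
  apply: (@cvg_comp _ _ _ B (fun M : 'M[Cx R]_(m, k) => M i j) _ (nbhs (B z)) _ (cB z Dz)).
  exact: coord_continuous.
have /cvg_ex[/= l Hl] := dB z Uz; apply/cvg_ex; exists (l i j).
have hc : continuous (fun M : 'M[Cx R]_(m, k) => M i j) by exact: coord_continuous.
have := cvg_comp _ _ Hl (hc l).
apply: cvg_trans; apply: near_eq_cvg; near=> h.
by rewrite /= !mxE.
Unshelve. all: by end_near. Qed.

End holomorphic_closure.

Section pairing.
Context {R : realType} {n : nat}.
Implicit Types (w x y : 'cV[Cx R]_n).

Definition pairing w x : Cx R := \sum_(i < n) (w i ord0)^*%C * x i ord0.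

Lemma Re_sum (J : Type) (js : seq J) (F : J -> Cx R) :
  complex.Re (\sum_(j <- js) F j) = \sum_(j <- js) complex.Re (F j).
Proof. by elim: js => [|j js IH]; rewrite ?big_nil // !big_cons ReD IH. Qed.

Lemma sum_cabs2_ge0 (x : 'cV[Cx R]_n) : 0 <= \sum_(i < n) cabs2 (x i ord0).
Proof. by apply: sumr_ge0 => i _; rewrite addr_ge0 ?sqr_ge0. Qed.

Lemma sqr_vnorm2 x : vnorm2 x ^+ 2 = \sum_(i < n) cabs2 (x i ord0).
Proof. by rewrite sqr_sqrtr // sum_cabs2_ge0. Qed.

Lemma Re_pairing_self w : complex.Re (pairing w w) = vnorm2 w ^+ 2.
Proof.
rewrite sqr_vnorm2 Re_sum; apply: eq_bigr => i _.
by rewrite /cabs2; case: (w i ord0) => c d /=; ring.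
Qed.

Lemma pairingB w x y : pairing w (x - y) = pairing w x - pairing w y.
Proof. by rewrite /pairing -sumrB; apply: eq_bigr => i _; rewrite !mxE mulrBr. Qed.

Lemma cabs_pairing w x : cabs (pairing w x) <= vnorm2 w * vnorm2 x.
Proof.
have h1 : cabs (pairing w x) <= \sum_(i < n) cabs (w i ord0) * cabs (x i ord0).
  apply: (big_ind2 (fun (u : Cx R) v => cabs u <= v)) => [|u1 v1 u2 v2 h1 h2|i _].
  - by rewrite cabs0.
  - by apply: le_trans (cabsD _ _) _; exact: lerD.
  - rewrite cabsM; have -> : cabs (w i ord0)^*%C = cabs (w i ord0) => //.
    by rewrite /cabs /cabs2; case: (w i ord0) => c d /=; rewrite sqrrN.
have v0 (y : 'cV[Cx R]_n) : 0 <= vnorm2 y by exact: sqrtr_ge0.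
apply: le_trans h1 _; rewrite -(@ler_pXn2r _ 2) ?nnegrE ?mulr_ge0 //; last first.
  by apply: sumr_ge0 => i _; rewrite mulr_ge0 ?cabs_ge0.
have := @weighted_cauchy_schwarz R 'I_n (index_enum _) (fun i => cabs (w i ord0))
  (fun i => cabs (x i ord0)) (fun=> 1) (fun=> ltr01).
rewrite exprMn !sqr_vnorm2 => h; apply: le_trans h _; rewrite le_eqVlt; apply/orP; left.
apply/eqP; congr (_ * _); apply: eq_bigr => i _.
  by rewrite divr1 sqr_cabs.
by rewrite mul1r sqr_cabs.
Qed.

End pairing.

Section scalar_solution.
Context {R : realType} {n : nat} (rho : R).
Context (A : Cx R -> 'M[Cx R]_n) (b : Cx R -> 'cV[Cx R]_n) (w : 'cV[Cx R]_n).
Hypothesis A_cont : {within bernstein_closed rho, continuous A}.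
Hypothesis b_cont : {within bernstein_closed rho, continuous b}.
Hypothesis A_an : analytic_on (bernstein_open rho) A.
Hypothesis b_an : analytic_on (bernstein_open rho) b.
Hypothesis A_unit : forall z, bernstein_closed rho z -> A z \in unitmx.

(** The scalar function [g] of the overview, with Cramer's rule written out so that only sums,
    products and one inverse of entries occur, all covered by the [holo] lemmas. It agrees with the
    pairing on the closed ellipse, where [A z] is invertible. *)
Definition cramer (z : Cx R) : Cx R :=
  \sum_(i < n) (w i ord0)^*%C * ((\det (A z))^-1 * \sum_(j < n) (\adj (A z)) i j * b z j ord0).

Lemma cramerE z : bernstein_closed rho z -> cramer z = pairing w (solx A b z).
Proof.
move=> /A_unit Az; rewrite /cramer /pairing /solx; apply: eq_bigr => i _; congr (_ * _).
rewrite /invmx Az mxE mulr_sumr; apply: eq_bigr => j _.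
by rewrite [in RHS]mxE mulrA.
Qed.

Lemma cramer_holo : holo (bernstein_closed rho) (bernstein_open rho) cramer.
Proof.
have hA i j := @holo_entry R _ _ _ _ A i j A_cont A_an.
have hb j := @holo_entry R _ _ _ _ b j ord0 b_cont b_an.
apply: holo_sum => i; apply: holoM; first exact: holo_cst.
apply: holoM; last by apply: holo_sum => j; apply: holoM; [exact: holo_adj|exact: hb].
apply: holoV; last exact: holo_det.
- by move=> z; exact: ltW.
- by move=> z /A_unit; rewrite unitmxE unitfE.
Qed.

End scalar_solution.

Section least_squares.
Context {R : realType}.

(** The first-order condition at a minimum. At [e = a / (b + 1)] the expression is negative unless
    [a = 0]; the summand 1 covers [b = 0]. *)
Lemma quadratic_ge0 (a b : R) : 0 <= b -> (forall e : R, 0 <= - (2 * e * a) + e ^+ 2 * b) -> a = 0.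
Proof.
move=> b0 H; have b1 : 0 < b + 1 by rewrite ltr_wpDl.
have := H (a / (b + 1)).
have -> : - (2 * (a / (b + 1)) * a) + (a / (b + 1)) ^+ 2 * b = - (a ^+ 2 * ((b + 2) / (b + 1) ^+ 2)).
  by field; rewrite gt_eqF.
rewrite oppr_ge0 => h; apply/eqP; rewrite -sqrf_eq0 eq_le sqr_ge0 andbT.
by move: h; rewrite pmulr_lle0 // divr_gt0 ?exprn_gt0 //; lra.
Qed.

Lemma cR_sum (J : Type) (js : seq J) (F : J -> R) :
  \sum_(j <- js) cR (F j) = cR (\sum_(j <- js) F j).
Proof.
elim: js => [|j js IH]; first by rewrite !big_nil.
by rewrite !big_cons IH; apply/eqP; rewrite eq_complex /= addr0 !eqxx.
Qed.

Context {n M d : nat} (x : Cx R -> 'cV[Cx R]_n) (P : 'I_d.+1 -> 'cV[Cx R]_n).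
Hypothesis P_min : forall Q : 'I_d.+1 -> 'cV[Cx R]_n,
  frob (samples M x - samples M (polyvec P)) <= frob (samples M x - samples M (polyvec Q)).
Variable w : 'cV[Cx R]_n.

Definition re_poly : {poly R} := \poly_(j < d.+1) complex.Re (pairing w (P (inord j))).

Lemma size_re_poly : (size re_poly <= d.+1)%N. Proof. exact: size_poly. Qed.

Lemma re_polyE (r : R) : re_poly.[r] = complex.Re (pairing w (polyvec P (cR r))).
Proof.
rewrite horner_poly /pairing /polyvec.
transitivity (\sum_(j < d.+1) \sum_(i < n) r ^+ j * complex.Re ((w i ord0)^*%C * P j i ord0)).
  apply: eq_bigr => j _; rewrite inord_val Re_sum mulr_suml.
  by apply: eq_bigr => i _; rewrite mulrC.
rewrite exchange_big Re_sum; apply: eq_bigr => i _ /=.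
rewrite summxE mulr_sumr Re_sum; apply: eq_bigr => j _.
by rewrite mxE cRX mulrCA Re_cRM.
Qed.

Let e (k : 'I_M) := complex.Re (pairing w (x (cR (tau k)))) - re_poly.[tau k].

Lemma least_squares_orth (s : {poly R}) : (size s <= d.+1)%N ->
  \sum_(k < M) s.[tau k] * e k = 0.
Proof.
move=> ss.
have sE (z : R) : \sum_(j < d.+1) cR z ^+ j * cR s`_j = cR s.[z].
  rewrite (horner_coef_wide _ ss) -cR_sum; apply: eq_bigr => j _.
  by rewrite cRX cRM mulrC.
(* The competitor moves [polyvec P] along [w] by the real amount [eps * s]; the objective changes by
   a quadratic in [eps] whose linear coefficient is [-2] times the sum in question. *)
pose Q (eps : R) j := P j + cR (eps * s`_j) *: w.
have QE (eps z : R) : polyvec (Q eps) (cR z) = polyvec P (cR z) + cR (eps * s.[z]) *: w.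
  rewrite -cRM -sE mulr_sumr scaler_suml /polyvec -big_split; apply: eq_bigr => j _ /=.
  by rewrite /Q scalerDr scalerA -cRM mulrCA.
pose u k := x (cR (@tau R M k)) - polyvec P (cR (tau k)).
have eE k : e k = complex.Re (pairing w (u k)).
  rewrite /e re_polyE /u pairingB; case: (pairing _ _) => ? ?; by case: (pairing _ _).
apply: (@quadratic_ge0 _ (\sum_(k < M) s.[tau k] ^+ 2 * vnorm2 w ^+ 2)).
  by apply: sumr_ge0 => k _; rewrite mulr_ge0 ?sqr_ge0.
move=> eps.
have cabs2_expand (c v : Cx R) (r : R) :
    cabs2 (c - cR r * v) = cabs2 c - 2 * r * complex.Re (v^*%C * c) + r ^+ 2 * cabs2 v.
  by rewrite /cabs2; case: c => ? ?; case: v => ? ? /=; ring.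
have nonneg k l (X : 'M[Cx R]_(k, l)) : 0 <= \sum_(i < k) \sum_(j < l) cabs2 (X i j).
  by apply: sumr_ge0 => i _; apply: sumr_ge0 => j _; rewrite addr_ge0 ?sqr_ge0.
have := P_min (Q eps); rewrite ler_sqrt // -subr_ge0.
rewrite exchange_big /= [X in _ - X]exchange_big /= -sumrB.
rewrite mulr_sumr -sumrN mulr_sumr -big_split /=.
suff -> : \sum_(j < M) (\sum_(i < n) cabs2 ((samples M x - samples M (polyvec (Q eps))) i j)
   - \sum_(i < n) cabs2 ((samples M x - samples M (polyvec P)) i j)) =
  \sum_(k < M) (- (2 * eps * (s.[tau k] * e k)) + eps ^+ 2 * (s.[tau k] ^+ 2 * vnorm2 w ^+ 2)) by [].
apply: eq_bigr => k _; rewrite -sumrB eE Re_sum sqr_vnorm2.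
rewrite !mulr_sumr -sumrN -big_split; apply: eq_bigr => i _ /=.
rewrite !mxE QE !mxE opprD addrA cabs2_expand; ring.
Qed.

(** Pythagoras: the residual [e] is orthogonal on the nodes to [re_poly - q], so the two sides
    differ by the sum of the [e k ^+ 2]. *)
Lemma least_squares_proj (q : {poly R}) : (size q <= d.+1)%N ->
  \sum_(k < M) (re_poly.[tau k] - q.[tau k]) ^+ 2 <=
  \sum_(k < M) (complex.Re (pairing w (x (cR (tau k)))) - q.[tau k]) ^+ 2.
Proof.
move=> sq; have sp : (size (re_poly - q)%R <= d.+1)%N.
  by rewrite (leq_trans (size_polyD _ _)) // size_polyN geq_max size_re_poly.
have := least_squares_orth sp => H.
rewrite -subr_ge0 -sumrB.
rewrite (_ : \sum_(k < M) _ = \sum_(k < M) e k ^+ 2 + 2 * \sum_(k < M) (re_poly - q).[tau k] * e k).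
  by rewrite H mulr0 addr0 sumr_ge0 // => k _; exact: sqr_ge0.
rewrite mulr_sumr -big_split; apply: eq_bigr => k _ /=.
by rewrite hornerD hornerN /e; ring.
Qed.

End least_squares.

(** * Extrapolation from the nodes and the final estimate *)

Lemma extrapolate {R : realType} (M d : nat) (p : {poly R}) (t s B : R) :
  (2 <= M)%N -> (size p <= d.+1)%N -> 4 * d%:R ^+ 2 <= M%:R - 1 :> R ->
  1 <= t -> 1 < s -> s + s^-1 = 2 * t -> 0 <= B ->
  \sum_(k < M) p.[tau k] ^+ 2 <= M%:R * B ^+ 2 ->
  `|p.[t]| <= CMR M d * (s ^+ d.+1 / Num.sqrt (s ^+ 2 - 1)) * B.
Proof.
move=> M2 sp dM t1 s1 st B0 pB.
have M1 : 0 < M%:R - 1 :> R by rewrite subr_gt0 ltr1n.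
have s2 : 0 < s ^+ 2 - 1 by rewrite subr_gt0 exprn_egt1 // ltW.
have s0 : 0 <= s by rewrite (le_trans ler01) // ltW.
have C0 : 0 <= CMR M d :> R by rewrite /CMR !(mulr_ge0, invr_ge0) ?sqrtr_ge0.
have C2 : CMR M d ^+ 2 = 125 * (2 * d%:R + 1) * M%:R / (2 * (M%:R - 1)) :> R.
  rewrite /CMR !exprMn exprVn !sqr_sqrtr ?addr_ge0 ?mulr_ge0 ?ler0n ?(ltW M1) //.
  by field; rewrite gt_eqF.
set T : R := CMR M d * (s ^+ d.+1 / Num.sqrt (s ^+ 2 - 1)) * B.
have T0 : 0 <= T by rewrite !mulr_ge0 ?exprn_ge0 // invr_ge0 sqrtr_ge0.
rewrite -(@ler_pXn2r _ 2) ?nnegrE // real_normK ?num_real //.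
have T2 : T ^+ 2 = 125 * (2 * d%:R + 1) * M%:R / (2 * (M%:R - 1)) *
   (s ^+ d.+1 ^+ 2 / (s ^+ 2 - 1)) * B ^+ 2.
  by rewrite /T exprMn (exprMn 2 (CMR M d)) C2 expr_div_n sqr_sqrtr // ltW.
have := poly_growth sp t1 s1 st.
set V := s ^+ d.+1 ^+ 2 / _ in T2 *; set I := pint _ _ _ => h.
have V0 : 0 <= V by rewrite divr_ge0 ?sqr_ge0 // ltW.
clearbody V; apply: (le_trans h); rewrite {}T2.
have hI : I <= 16 / (M%:R - 1) * (M%:R * B ^+ 2).
  apply: (le_trans (grid_bound M2 sp dM)).
  by rewrite ler_wpM2l // divr_ge0 // ltW.
have W0 : 0 <= (2 * d + 1)%:R / 2 * V by rewrite mulr_ge0 // divr_ge0 ?ler0n.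
apply: (le_trans (ler_wpM2l W0 hI)).
have E : (2 * d + 1)%:R = 2 * d%:R + 1 :> R by rewrite natrD natrM.
(* The growth estimate and the grid estimate give 8 where [CMR M d ^+ 2] has [125 / 2]; the
   difference is the [109 / 2] below. *)
rewrite E -subr_ge0.
have -> : 125 * (2 * d%:R + 1) * M%:R / (2 * (M%:R - 1)) * V * B ^+ 2 -
   (2 * d%:R + 1) / 2 * V * (16 / (M%:R - 1) * (M%:R * B ^+ 2)) =
   (109 / 2) * (2 * d%:R + 1) * M%:R / (M%:R - 1) * V * B ^+ 2.
  by field; rewrite gt_eqF.
by rewrite !mulr_ge0 ?sqr_ge0 ?addr_ge0 ?mulr_ge0 // ?invr_ge0 // ltW.
Qed.

Lemma tau_itv {R : realType} (M : nat) (k : 'I_M) : (2 <= M)%N -> -1 <= (tau k : R) <= 1.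
Proof.
move=> M2; have M1 : 0 < M%:R - 1 :> R by rewrite subr_gt0 ltr1n.
have k0 : 0 <= k%:R * (2 / (M%:R - 1)) :> R by rewrite mulr_ge0 // divr_ge0 // ltW.
rewrite /tau lerDl k0 /= -lerBrDl opprK mulrA ler_pdivrMr // mulrC.
rewrite -[1 + 1]/(2 : R) ler_pM2l // lerBrDr natr1 ler_nat; exact: ltn_ord.
Qed.

Lemma foci_cR {R : realType} (a : R) :
  cabs (cR a - 1) + cabs (cR a + 1) = `|a - 1| + `|a + 1|.
Proof.
have -> : cR a - 1 = cR (a - 1) by apply/eqP; rewrite eq_complex /= subr0 !eqxx.
have -> : cR a + 1 = cR (a + 1) by apply/eqP; rewrite eq_complex /= addr0 !eqxx.
by rewrite !cabs_cR.
Qed.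

Lemma unit_joukowski {R : realType} (a : R) : -1 <= a <= 1 ->
  exists2 z : Cx R, cabs z = 1 & z + z^-1 = cR (2 * a).
Proof.
move=> /andP[al ar]; pose y := Num.sqrt (1 - a ^+ 2).
have y2 : y ^+ 2 = 1 - a ^+ 2.
  rewrite sqr_sqrtr // (_ : _ - _ = (1 - a) * (a + 1)); last by ring.
  by apply: mulr_ge0; lra.
have z1 : cabs (Complex a y) = 1.
  by rewrite /cabs /cabs2 /= y2 addrC subrK sqrtr1.
exists (Complex a y) => //.
have z0 : (Complex a y : Cx R) != 0 by rewrite -cabs_eq0 z1 oner_eq0.
have -> : (Complex a y : Cx R)^-1 = Complex a (- y).
  apply: (mulfI z0); rewrite mulfV //.
  apply/eqP; rewrite eq_complex /= mulrN opprK -!expr2 y2 addrC subrK eqxx.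
  by rewrite mulrN mulrC addrC subrr eqxx.
by apply/eqP; rewrite eq_complex /= subrr eqxx andbT mulrDl mul1r.
Qed.

Theorem theorem3 (R : realType) (n : nat) (rho : R)
    (A : Cx R -> 'M[Cx R]_n) (b : Cx R -> 'cV[Cx R]_n)
    (kappa : R) (M d : nat) (P : 'I_d.+1 -> 'cV[Cx R]_n) (t : R) :
  (1 <= n)%N ->
  1 < rho ->
  {within bernstein_closed rho, continuous A} ->
  {within bernstein_closed rho, continuous b} ->
  analytic_on (bernstein_open rho) A ->
  analytic_on (bernstein_open rho) b ->
  (forall z, bernstein_closed rho z -> A z \in unitmx) ->
  (* kappa_rho = max over the boundary of ||x(t)||_2 *)
  (exists2 z0, bernstein_boundary rho z0 & vnorm2 (solx A b z0) = kappa) ->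
  (forall z, bernstein_boundary rho z -> vnorm2 (solx A b z) <= kappa) ->
  (2 <= M)%N ->
  (d%:R : R) <= Num.sqrt (M%:R - 1) / 2 ->
  (* P is the coefficient tuple of the least-squares minimizer p_R *)
  (forall Q : 'I_d.+1 -> 'cV[Cx R]_n,
     frob (samples M (solx A b) - samples M (polyvec P))
       <= frob (samples M (solx A b) - samples M (polyvec Q))) ->
  1 < t -> t < (rho + rho^-1) / 2 ->
  let r := (t + Num.sqrt (t ^+ 2 - 1)) / rho in
  vnorm2 (solx A b (cR t) - polyvec P (cR t))
    <= 2 * kappa * ((1 - r)^-1
                    + CMR M d * rho / ((rho - 1) * Num.sqrt (rho ^+ 2 * r ^+ 2 - 1)))
       * r ^+ d.+1.
Proof.
move=> _ rho1 A_cont b_cont A_an b_an A_unit [z0 _ kappaE] kappa_max M2 dM P_min t1 t_rho.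
cbv zeta; set r := _ / rho.
have rho0 : 0 < rho by exact: lt_trans rho1.
set s := t + _ in r *.
have t21 : 0 < t ^+ 2 - 1 by rewrite subr_gt0 exprn_egt1 // ltW.
have sq0 : 0 < Num.sqrt (t ^+ 2 - 1) by rewrite sqrtr_gt0.
have s1 : 1 < s by rewrite /s; lra.
have s0 : 0 < s by exact: lt_trans s1.
have sV : s^-1 = t - Num.sqrt (t ^+ 2 - 1).
  have s_neq0 : s != 0 by rewrite gt_eqF.
  apply: (mulfI s_neq0); rewrite mulfV // /s mulrC -subr_sqr sqr_sqrtr ?(ltW t21) //.
  by ring.
have st : s + s^-1 = 2 * t by rewrite sV /s; ring.
(* The map from [x] to [x + x^-1] is increasing above 1, and [s + s^-1 = 2 * t]. *)
have s_rho : s < rho.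
  rewrite ltNge; apply/negP => rs; have : 2 * t < rho + rho^-1 by lra.
  rewrite -st -subr_gt0 (_ : _ - _ = - ((s - rho) * (1 - (s * rho)^-1))).
    rewrite oppr_gt0 ltNge mulr_ge0 ?subr_ge0 //.
    by rewrite invf_le1 ?mulr_gt0 // mulr_ege1 // ltW.
  by field; rewrite !gt_eqF.
have rE : rho * r = s by rewrite /r mulrC divfK // gt_eqF.
rewrite -exprMn rE; set w := solx A b (cR t) - _; set W := vnorm2 w.
have W0 : 0 <= W by exact: sqrtr_ge0.
have kappa0 : 0 <= kappa by rewrite -kappaE sqrtr_ge0.
have r1 : r < 1 by rewrite /r ltr_pdivrMr // mul1r.
have r0 : 0 < r by rewrite divr_gt0.
have C0 : 0 <= CMR M d :> R.
  have M1 : 0 < M%:R - 1 :> R by rewrite subr_gt0 ltr1n.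
  by rewrite /CMR !(mulr_ge0, invr_ge0) ?sqrtr_ge0.
set S := Num.sqrt (s ^+ 2 - 1).
have S0 : 0 < S by rewrite sqrtr_gt0 subr_gt0 exprn_egt1 // ltW.
pose g := cramer A b w.
have [g_cont g_der] := cramer_holo w A_cont b_cont A_an b_an A_unit.
have g_bound z : bernstein_boundary rho z -> cabs (g z) <= W * kappa.
  move=> bz; rewrite /g (cramerE b w A_unit); last by rewrite /bernstein_closed /= le_eqVlt bz eqxx.
  by apply: le_trans (cabs_pairing _ _) _; rewrite ler_wpM2l ?kappa_max.
have two_rho : 2 <= rho + rho^-1.
  by have : 0 < rho + rho^-1 - 2 * t; lra.
have gE (a : R) : `|a - 1| + `|a + 1| <= rho + rho^-1 ->
    complex.Re (g (cR a)) = complex.Re (pairing w (solx A b (cR a))).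
  by move=> ha; rewrite /g (cramerE b w A_unit) // /bernstein_closed /= foci_cR.
pose q := cheb_trunc g d.
have near_q z (a : R) := @cheb_trunc_near R rho (W * kappa) g rho1 g_cont g_der g_bound d z a.
have at_t : `|complex.Re (pairing w (solx A b (cR t))) - q.[t]| <=
    2 * (W * kappa) * r ^+ d.+1 / (1 - r).
  have cs : cabs (cR s) = s by rewrite cabs_cR ger0_norm // ltW.
  rewrite -gE; last by rewrite !ger0_norm; lra.
  have := near_q (cR s) t; rewrite cs; apply => //; first exact: ltW.
  by rewrite -st cRV ?gt_eqF // cRD.
(* The bound of [cheb_trunc_near] on the unit circle. Its denominator produces the factor
   [rho / (rho - 1)], and its power of [rho] turns [s ^+ d.+1] into [r ^+ d.+1]. *)
set beta := 2 * (W * kappa) * (1 / rho) ^+ d.+1 / (1 - 1 / rho).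
have at_tau k : `|complex.Re (pairing w (solx A b (cR (@tau R M k)))) - q.[tau k]| <= beta.
  have /andP[tl tr] := @tau_itv R M k M2.
  rewrite -gE; last by rewrite ler0_norm ?ger0_norm; lra.
  have [z z1 zt] := unit_joukowski (introT andP (conj tl tr)).
  by have := near_q z (tau k); rewrite z1; apply.
have beta0 : 0 <= beta.
  have rhoV : 0 < 1 - 1 / rho by rewrite subr_gt0 ltr_pdivrMr // mul1r.
  apply: divr_ge0 (ltW rhoV); apply: mulr_ge0; first by rewrite !mulr_ge0.
  by rewrite exprn_ge0 // divr_ge0 // ltW.
have fit : `|(re_poly P w - q).[t]| <= CMR M d * (s ^+ d.+1 / S) * beta.
  apply: extrapolate => //; try exact: ltW.
  - rewrite (leq_trans (size_polyD _ _)) // size_polyN geq_max size_re_poly.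
    exact: size_cheb_trunc.
  - rewrite -[leRHS](@sqr_sqrtr _ (M%:R - 1)) ?subr_ge0 ?ler1n ?(ltnW M2) //.
    rewrite -[4]/((2 * 2)%:R : R) natrM -expr2 -exprMn ler_pXn2r ?nnegrE ?sqrtr_ge0 ?mulr_ge0 //.
    by rewrite mulrC -ler_pdivlMr.
  - apply: (@le_trans _ _ (\sum_(k < M) beta ^+ 2)); last first.
      by rewrite sumr_const card_ord mulr_natl lexx.
    under eq_bigr do rewrite hornerD hornerN.
    apply: le_trans (least_squares_proj P_min w (size_cheb_trunc g d)) _.
    apply: ler_sum => k _; rewrite -(real_normK (num_real (_ - _))).
    by rewrite ler_pXn2r ?nnegrE.
have key : W ^+ 2 <= W * (2 * kappa * ((1 - r)^-1 + CMR M d * rho / ((rho - 1) * S)) * r ^+ d.+1).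
  have -> : W ^+ 2 = (complex.Re (pairing w (solx A b (cR t))) - q.[t])
      - (re_poly P w - q).[t].
    rewrite -Re_pairing_self {2}/w pairingB hornerD hornerN re_polyE.
    by case: (pairing _ _) => ? ?; case: (pairing _ _) => ? ? /=; ring.
  apply: le_trans (ler_norm _) _; apply: le_trans (ler_normB _ _) _.
  apply: le_trans (lerD at_t fit) _; rewrite le_eqVlt; apply/orP; left; apply/eqP.
  have -> : s ^+ d.+1 = rho ^+ d.+1 * r ^+ d.+1 by rewrite -exprMn rE.
  rewrite /beta (expr_div_n 1 rho) expr1n; field.
  by rewrite !gt_eqF ?exprn_gt0 ?subr_gt0.
(* Dividing [key] by [W] requires [W != 0]; when [W = 0] it remains to see that the bound is
   nonnegative. *)
have [->|Wn0] := eqVneq W 0.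
  apply: mulr_ge0; last by rewrite exprn_ge0 // ltW.
  apply: mulr_ge0; first by rewrite mulr_ge0.
  apply: addr_ge0; first by rewrite invr_ge0 subr_ge0 ltW.
  apply: divr_ge0; first by rewrite mulr_ge0 // ltW.
  by rewrite mulr_ge0 ?subr_ge0 // ltW.
by rewrite expr2 ler_pM2l // lt0r Wn0 W0 in key.
Qed.
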